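(* Let $w(z,t)=|z|^2+4t$ on $\mathbb H=\mathbb C\times\mathbb R$. Then, for every $m\geq0$, $$P_m(\mathbb H)=H_m(\mathbb H)\oplus wP_{m-2}(\mathbb H)$$ as an algebraic direct sum. Equivalently, every $p_m\in P_m(\mathbb H)$ has a unique representation $p_m=h_m+wq_{m-2}$ with $h_m\in H_m(\mathbb H)$ and $q_{m-2}\in P_{m-2}(\mathbb H)$. After restriction to $S_\rho$, the two summands are not, in general, orthogonal in $L^2(S_\rho,\sigma)$ (that is, it is not true that for every $m$ the restrictions to $S_\rho$ of $H_m(\mathbb H)$ and of $wP_{m-2}(\mathbb H)$ are orthogonal).
   Context: $\mathbb H=\mathbb C\times\mathbb R$ is the first Heisenberg group, with $z=x+iy$ and coordinates $(x,y,t)$. The horizontal fields are $X=\partial_x+2y\partial_t$, $Y=\partial_y-2x\partial_t$, and the sub-Laplacian is $\Delta_H=X^2+Y^2$. Dilations are $\delta_r(z,t)=(rz,r^2t)$, $r>0$. $P_m(\mathbb H)$ is the space of polynomials $p$ in $(x,y,t)$ with complex coefficients such that $p\circ\delta_r=r^mp$ for every $r>0$, with $P_j(\mathbb H)=\{0\}$ for $j<0$; $H_m(\mathbb H)=\ker(\Delta_H|_{P_m(\mathbb H)})$. $S_\rho=\{(z,t):|z|^4+t^2=1\}$, and $\sigma$ is the finite measure on $S_\rho$ determined by $\int_{\mathbb H}f\,dz\,dt=\int_0^\infty\int_{S_\rho}f(\delta_s\omega)\,s^3\,d\sigma(\omega)\,ds$, with Lebesgue measure $dz\,dt$ on $\mathbb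 R^2\times\mathbb R$. *)

(* Defs.v *)
From HB Require Import structures.
From mathcomp Require Import all_boot all_order all_algebra.
From mathcomp Require Import all_classical all_reals all_analysis.
From mathcomp Require Import measurable_realfun complex.
(* The notations of mpoly clash with those of all_analysis. *)
From mathcomp Require Import -(notations) mpoly.

Set Implicit Arguments.
Unset Strict Implicit.
Unset Printing Implicit Defensive.

Import Order.TTheory GRing.Theory Num.Theory.
Import numFieldNormedType.Exports.

Local Open Scope classical_set_scope.
Local Open Scope ring_scope.
Local Open Scope complex_scope.

(* The point (x + iy, t) of C x R is (x, y, t). *)
Notation heis R := (R * R * R)%type.

(* Polynomials in (x, y, t) = ('X_0, 'X_1, 'X_2) with complex coefficients. *)
Notation hpoly R := (mpoly 3 R[i]).

Definition xX {R : realType} : hpoly R := mpolyX R[i] (mnm1 (inord 0)).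
Definition yX {R : realType} : hpoly R := mpolyX R[i] (mnm1 (inord 1)).
Definition tX {R : realType} : hpoly R := mpolyX R[i] (mnm1 (inord 2)).

Definition dx {R : realType} (p : hpoly R) : hpoly R := mderiv (inord 0) p.
Definition dy {R : realType} (p : hpoly R) : hpoly R := mderiv (inord 1) p.
Definition dt {R : realType} (p : hpoly R) : hpoly R := mderiv (inord 2) p.

Definition fieldX {R : realType} (p : hpoly R) : hpoly R :=
  dx p + 2 * yX * dt p.
Definition fieldY {R : realType} (p : hpoly R) : hpoly R :=
  dy p - 2 * xX * dt p.
Definition subLaplacian {R : realType} (p : hpoly R) : hpoly R :=
  fieldX (fieldX p) + fieldY (fieldY p).

Definition heval {R : realType} (p : hpoly R) (a : heis R) : R[i] :=
  let: (x, y, t) := a in meval (tnth [tuple x%:C; y%:C; t%:C]) p.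

Definition dil {R : realType} (r : R) (a : heis R) : heis R :=
  let: (x, y, t) := a in (r * x, r * y, r ^+ 2 * t).

Definition Phom {R : realType} (m : int) : set (hpoly R) :=
  match m with
  | Posz n => [set p | forall r : R, 0 < r ->
                 forall a : heis R, heval p (dil r a) = r%:C ^+ n * heval p a]
  | Negz _ => [set 0]
  end.

Definition Hharm {R : realType} (m : int) : set (hpoly R) :=
  [set p | Phom m p /\ subLaplacian p = 0].

Definition wpoly {R : realType} : hpoly R := xX ^+ 2 + yX ^+ 2 + 4 * tX.

Definition wPhom {R : realType} (m : int) : set (hpoly R) :=
  [set wpoly * q | q in Phom m].

Definition direct_sum {R : realType} (A B C : set (hpoly R)) : Prop :=
  A = [set b + c | b in B & c in C] /\ B `&` C = [set 0].

Definition S_rho {R : realType} : set (heis R) :=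
  [set a | let: (x, y, t) := a in (x ^+ 2 + y ^+ 2) ^+ 2 + t ^+ 2 = 1].

(* A measure on S_rho is encoded as a measure on the whole space for which
   the complement of S_rho is null. *)
Definition is_surface_measure {R : realType}
    (sigma : {finite_measure set (heis R) -> \bar R}) : Prop :=
  sigma (~` S_rho) = 0%E /\
  forall f : heis R -> \bar R,
    measurable_fun setT f -> (forall a, (0 <= f a)%E) ->
    (\int[(@lebesgue_measure R \x @lebesgue_measure R)
           \x @lebesgue_measure R]_a f a =
     \int[@lebesgue_measure R]_(s in `]0%R, +oo[)
       \int[sigma]_(a in S_rho) (f (dil s a) * (s ^+ 3)%:E))%E.

(* The library integral is real-valued, hence the two components. *)
Definition L2dot {R : realType} (sigma : {measure set (heis R) -> \bar R})
    (g1 g2 : heis R -> R[i]) : R[i] :=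
  let g a := g1 a * (g2 a)^* in
  (\int[sigma]_(a in S_rho) complex.Re (g a)) +i*
  (\int[sigma]_(a in S_rho) complex.Im (g a)).

Definition orthogonal_on_S {R : realType}
    (sigma : {measure set (heis R) -> \bar R}) (A B : set (hpoly R)) : Prop :=
  forall p q, A p -> B q -> L2dot sigma (heval p) (heval q) = 0.

(* Main.v *)
Require Import Defs.
From HB Require Import structures.
From mathcomp Require Import all_boot all_order all_algebra.
From mathcomp Require Import all_classical all_reals all_analysis.
From mathcomp Require Import measurable_realfun complex.
From mathcomp Require Import -(notations) mpoly.
From mathcomp Require Import ring lra zify.

(** Put z = x + iy and r = |z|^2, so that w = r + 4t.  Both halves of the
    theorem come from one family of harmonic polynomials,
      h = z^k sum_j C(N,j) (ir)^j t^(N-j) e_j   and its mirror image in z-bar,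
    where e_j is the j-th moment of the probability density proportional to
    (1-s)^(-1/2) (1+s)^(k-1/2) on [-1,1]; that is, h = z^k E[(t + irs)^N], a
    Laplace type integral.  Only the recursion (k+j+1) e_(j+1) = k e_j + j
    e_(j-1) of the moments is used, and it is exactly what makes h harmonic
    ([umbral_harmonic]).

    Direct sum.  The claim is that q |-> Lap(w q) is bijective on every P_n;
    then p = (p - w q) + w q for the unique q with Lap(w q) = Lap p.

    Surjectivity splits in two.  First, P_m = H_m + w P_(m-2).  Modulo w one
    has t = -r/4, so P_m is spanned modulo w by the monomials z^(k+N) zbar^N
    and their mirror images, and h reduces to such a monomial times (-1/4)^N
    M_N, where M_N = sum_j C(N,j) c^j e_j with c = -4i. So everything hinges
    on M_N <> 0.  The moment recursion gives
      (N+k+2) M_(N+2) = (2(N+1) + k + 1 + kc) M_(N+1) - 17 (N+1) M_N.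
    For k > 0 the term kc is purely imaginary and forces the sign of
    Im(M_(N+1) conj(M_N)) to be constant, by induction on N
    ([umbral_moment_neq0]).  For k = 0 the sum is sum_j C(N,2j) C(2j,j)
    (-4)^j, an odd integer ([umbral_moment0_neq0]). Second, Lap maps P_(n+2)
    onto P_n: its leading part in t sends z^(a+1) zbar^(b+1) t^c to
    4(a+1)(b+1) z^a zbar^b t^c, the other terms having lower degree in t
    ([subLaplacian_onto_monomial]).

    Injectivity then holds because P_n is finite-dimensional
    ([surjective_injective]).

    Non-orthogonality.  Take m = 3, the harmonic polynomial z (t + ir/2) and
    the multiple w z of w.  The real and imaginary parts of their inner
    product are the integrals of r t w and of r^2 w / 2 over the sphere;
    orthogonality would make both vanish, hence also the integral of r^2 w + 4
    r t w = r w^2 >= 0.  As r w^2 is homogeneous under dilations, the polar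
    formula would then give it Lebesgue integral 0 on R^3, although it is at
    least 1 on a box of volume 1. *)

Set Implicit Arguments.
Unset Strict Implicit.
Unset Printing Implicit Defensive.

Import Order.TTheory GRing.Theory Num.Theory.
Local Open Scope ring_scope.

(** * Umbral powers *)

(** This is sum_j C(N,j) a^j b^(N-j) f_j, the value at index 0 of (b + a S)^N
    f with S the shift of sequences; when f is the moment sequence of a
    measure mu, it is the integral of (b + a s)^N with respect to mu.  In the
    recursive form every identity below is an induction on N, without
    manipulation of binomial coefficients. *)
Fixpoint umbral (A : comNzRingType) (a b : A) (N : nat) (f : nat -> A) : A :=
  if N is n.+1 then b * umbral a b n f + a * umbral a b n (fun j => f j.+1)
  else f 0%N.

Lemma eq_umbral (A : comNzRingType) (a b : A) N f g :
  f =1 g -> umbral a b N f = umbral a b N g.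
Proof.
elim: N f g => [|N IH] f g fg /=; first exact: fg.
by rewrite (IH f g fg) (IH _ (fun j => g j.+1) (fun j => fg j.+1)).
Qed.

Lemma umbral_lin (A : comNzRingType) (a b : A) N c f g :
  umbral a b N (fun j => c * f j + g j) = c * umbral a b N f + umbral a b N g.
Proof.
elim: N f g => [//|N IH] f g /=.
by rewrite IH (IH (fun j => f j.+1)); ring.
Qed.

Lemma umbral0 (A : comNzRingType) (a b : A) N : umbral a b N (fun=> 0) = 0.
Proof. by elim: N => //= N ->; ring. Qed.

Lemma umbralS (A : comNzRingType) (a b : A) N f :
  umbral a b N.+1 f = b * umbral a b N f + a * umbral a b N (fun j => f j.+1).
Proof. by []. Qed.

(** The absorption identity j C(N+1,j) = (N+1) C(N,j-1), in umbral form. *)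
Lemma umbral_absorb (A : comNzRingType) (a b : A) N f :
  umbral a b N.+1 (fun j => j%:R * f j.-1) = N.+1%:R * a * umbral a b N f.
Proof.
elim: N f => [|N IH] f; first by rewrite /=; ring.
rewrite umbralS IH.
rewrite (@eq_umbral _ a b N.+1 _ (fun j => 1 * f j + j%:R * f j.-1.+1));
  last by case=> [|j] /=; rewrite ?mul0r; ring.
rewrite umbral_lin (IH (fun j => f j.+1)) umbralS.
by rewrite -[N.+2]add1n (natrD _ 1 N.+1); ring.
Qed.

Lemma umbral_absorbl (A : comNzRingType) (a b : A) N f :
  umbral a b N (fun j => j%:R * f j.-1) = N%:R * a * umbral a b N.-1 f.
Proof. by case: N => [|N]; rewrite ?umbral_absorb //=; ring. Qed.

Lemma umbral_absorbr (A : comNzRingType) (a b : A) N f :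
  umbral a b N (fun j => j%:R * f j.+1) =
  N%:R * a * umbral a b N.-1 (fun j => f j.+2).
Proof.
rewrite -(umbral_absorbl a b N (fun j => f j.+2)).
by apply: eq_umbral => -[|j]; rewrite ?mul0r.
Qed.

Lemma umbral_scale (A : comNzRingType) (s a b : A) N f :
  umbral (s * a) (s * b) N f = s ^+ N * umbral a b N f.
Proof. by elim: N f => [|N IH] f /=; rewrite ?IH ?exprS; ring. Qed.

Lemma umbral_scalel (A : comNzRingType) (s a b : A) N f :
  umbral (s * a) b N f = umbral a b N (fun j => s ^+ j * f j).
Proof.
elim: N f => [|N IH] f /=; first by ring.
rewrite !IH; congr (_ + _).
rewrite (@eq_umbral _ a b N (fun j => s ^+ j.+1 * f j.+1)
  (fun j => s * (s ^+ j * f j.+1) + 0)); last by move=> j; rewrite exprS; ring.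
by rewrite umbral_lin umbral0; ring.
Qed.

Lemma rmorph_umbral (A B : comNzRingType) (phi : {rmorphism A -> B}) a b N f :
  phi (umbral a b N f) = umbral (phi a) (phi b) N (fun j => phi (f j)).
Proof. by elim: N f => //= N IH f; rewrite rmorphD !rmorphM !IH. Qed.

(** * Derivations *)

Definition derivation (A : comNzRingType) (D : A -> A) :=
  {morph D : p q / p + q} /\ (forall p q, D (p * q) = D p * q + p * D q).

(** The chain rule for (b + a S)^N, the sequence f being made of constants. *)
Lemma derivation_umbral (A : comNzRingType) (D : A -> A) (a b : A) N f :
  derivation D -> (forall j, D (f j) = 0) ->
  D (umbral a b N f) =
  N%:R * (D a * umbral a b N.-1 (fun j => f j.+1) + D b * umbral a b N.-1 f).
Proof.
move=> [DD DM]; case: N => [|N] Df; first by rewrite /= Df mul0r.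
elim: N f Df => [|N IH] f Df; first by rewrite /= DD !DM !Df; ring.
rewrite umbralS DD !DM !IH // !umbralS.
by rewrite -[N.+2%:R]/((1 + N.+1)%:R) natrD; ring.
Qed.

Lemma derivation1 (A : comNzRingType) (D : A -> A) : derivation D -> D 1 = 0.
Proof.
move=> [_ DM]; apply: (addrI (D 1)).
by rewrite addr0 -[in RHS](mulr1 1) DM mulr1 mul1r.
Qed.

Lemma derivation_exp (A : comNzRingType) (D : A -> A) (u : A) n :
  derivation D -> D (u ^+ n) = n%:R * u ^+ n.-1 * D u.
Proof.
move=> dD; have DM := dD.2.
elim: n => [|[|n] IH]; first by rewrite expr0 derivation1 //; ring.
  by rewrite expr1 expr0; ring.
rewrite exprS DM IH /= [u ^+ n.+1]exprS -[n.+2%:R]/((1 + n.+1)%:R) natrD; ring.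
Qed.

Lemma derivation_nat (A : comNzRingType) (D : A -> A) n :
  derivation D -> D n%:R = 0.
Proof.
move=> dD; have D0 : D 0 = 0 by apply: (addrI (D 0)); rewrite -dD.1 !addr0.
elim: n => [//|n IH].
by rewrite -[n.+1]addn1 natrD dD.1 IH derivation1 // addr0.
Qed.

Lemma derivationN (A : comNzRingType) (D : A -> A) p :
  derivation D -> D (- p) = - D p.
Proof.
move=> dD; apply/eqP; rewrite -subr_eq0 opprK -dD.1 addNr.
by rewrite (derivation_nat 0 dD).
Qed.

Lemma derivation_comb (A : comNzRingType) (D E : A -> A) (c : A) :
  derivation D -> derivation E -> derivation (fun p => D p + c * E p).
Proof.
by move=> [DD DM] [ED EM]; split=> p q; rewrite ?(DD, ED, DM, EM); ring.
Qed.

(** X^2 + Y^2 factors through the complex fields X + iY and X - iY; since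
    these do not commute, only their symmetrized product gives it back. *)
Lemma sum_of_squares_derivation (A : comNzRingType) (X Y : A -> A) (c p : A) :
  derivation X -> derivation Y -> X c = 0 -> Y c = 0 -> c * c = -1 ->
  2 * (X (X p) + Y (Y p)) =
  (X (X p + c * Y p) + - c * Y (X p + c * Y p)) +
  (X (X p + - c * Y p) + c * Y (X p + - c * Y p)).
Proof.
move=> dX dY Xc Yc cc; rewrite !(dX.1, dY.1, dX.2, dY.2).
rewrite !(derivationN _ dX, derivationN _ dY) Xc Yc.
by ring: cc.
Qed.

Lemma sum_of_squaresD (A : comNzRingType) (X Y : A -> A) :
  derivation X -> derivation Y ->
  {morph (fun p => X (X p) + Y (Y p)) : p q / p + q}.
Proof. by move=> dX dY p q; rewrite !(dX.1, dY.1) addrACA. Qed.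

Lemma sum_of_squaresZ (A : comNzRingType) (X Y : A -> A) c p :
  derivation X -> derivation Y -> X c = 0 -> Y c = 0 ->
  X (X (c * p)) + Y (Y (c * p)) = c * (X (X p) + Y (Y p)).
Proof.
by move=> dX dY Xc Yc; rewrite !(dX.2, Xc, dY.2, Yc, mul0r, add0r) mulrDr.
Qed.

(** With D1 = X - iY, D2 = X + iY, u = z and v = z-bar, this is the action of
    the sub-Laplacian on monomials.  The predecessors are harmless at c = 0
    and c = 1, where the coefficients in front of them vanish. *)
Lemma sum_of_squares_monomial (A : comNzRingType) (D1 D2 : A -> A) (i u v t : A)
    (a b c : nat) :
  derivation D1 -> derivation D2 -> D1 i = 0 -> D2 i = 0 -> i * i = -1 ->
  D1 u = 2 -> D1 v = 0 -> D1 t = 2 * i * v ->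
  D2 u = 0 -> D2 v = 2 -> D2 t = - (2 * i * u) ->
  let m := u ^+ a.+1 * v ^+ b.+1 * t ^+ c in
  D1 (D2 m) + D2 (D1 m) =
  2 * (4 * a.+1%:R * b.+1%:R * (u ^+ a * v ^+ b * t ^+ c)
     - 4 * i * (a%:R - b%:R) * (c%:R * (u ^+ a.+1 * v ^+ b.+1 * t ^+ c.-1))
     + 4 * (c%:R * c.-1%:R * (u ^+ a.+2 * v ^+ b.+2 * t ^+ c.-2))).
Proof.
move=> d1 d2 i1 i2 ii u1 v1 t1 u2 v2 t2 m.
have D1m k l n : D1 (u ^+ k * v ^+ l * t ^+ n) =
    2 * k%:R * (u ^+ k.-1 * v ^+ l * t ^+ n)
  + 2 * i * n%:R * (u ^+ k * v ^+ l.+1 * t ^+ n.-1).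
  rewrite !d1.2 !(derivation_exp _ _ d1) u1 v1 t1 exprS.
  move: (_ ^+ k) (_ ^+ k.-1) (_ ^+ l) (_ ^+ l.-1) (_ ^+ n) (_ ^+ n.-1) => *.
  by ring.
have D2m k l n : D2 (u ^+ k * v ^+ l * t ^+ n) =
    2 * l%:R * (u ^+ k * v ^+ l.-1 * t ^+ n)
  - 2 * i * n%:R * (u ^+ k.+1 * v ^+ l * t ^+ n.-1).
  rewrite !d2.2 !(derivation_exp _ _ d2) u2 v2 t2 exprS.
  move: (_ ^+ k) (_ ^+ k.-1) (_ ^+ l) (_ ^+ l.-1) (_ ^+ n) (_ ^+ n.-1) => *.
  by ring.
have E1 k p : D1 (2 * k%:R * p) = 2 * k%:R * D1 p.
  by rewrite -natrM d1.2 (derivation_nat _ d1) mul0r add0r.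
have E2 k p : D2 (2 * k%:R * p) = 2 * k%:R * D2 p.
  by rewrite -natrM d2.2 (derivation_nat _ d2) mul0r add0r.
have F1 k p : D1 (2 * i * k%:R * p) = 2 * i * k%:R * D1 p.
  by rewrite [2 * i * _]mulrAC -natrM d1.2 d1.2 (derivation_nat _ d1) i1; ring.
have F2 k p : D2 (2 * i * k%:R * p) = 2 * i * k%:R * D2 p.
  by rewrite [2 * i * _]mulrAC -natrM d2.2 d2.2 (derivation_nat _ d2) i2; ring.
rewrite /m D2m D1m d1.1 d2.1 (derivationN _ d1) E1 E2 F1 F2 !D1m !D2m /=.
rewrite !(exprS _ a.+1) !(exprS _ a) !(exprS _ b.+1) !(exprS _ b).
rewrite -[a.+2%:R]/((1 + (1 + a))%:R) -[a.+1%:R]/((1 + a)%:R).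
rewrite -[b.+2%:R]/((1 + (1 + b))%:R) -[b.+1%:R]/((1 + b)%:R) !natrD.
move: (_ ^+ a) (_ ^+ b) (_ ^+ c) (_ ^+ c.-1) (_ ^+ c.-2) => *; ring: ii.
Qed.

(** * The moments and their umbral powers *)

(** Satisfied by the moments of the density (1-s)^(-1/2) (1+s)^(k-1/2) on
    [-1,1]: integrate the derivative of s^j (1-s)^(1/2) (1+s)^(k+1/2). *)
Definition moment_rec (A : comNzRingType) (k : nat) (e : nat -> A) :=
  forall j, (k + j.+1)%:R * e j.+1 = k%:R * e j + j%:R * e j.-1.

Lemma umbral_moment (A : comNzRingType) (k : nat) (e : nat -> A) a b N :
  moment_rec k e ->
  k.+1%:R * umbral a b N (fun j => e j.+1)
  + umbral a b N (fun j => j%:R * e j.+1)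
  = k%:R * umbral a b N e + umbral a b N (fun j => j%:R * e j.-1).
Proof.
move=> He; rewrite -!umbral_lin; apply: eq_umbral => j.
by rewrite -He -mulrDl -natrD addSnnS.
Qed.

(** Absorption turns the sum of the moment recursions, weighted by C(N+1,j)
    c^j, into a relation between consecutive umbral powers. *)
Lemma umbral_three_term (A : comNzRingType) (k : nat) (e : nat -> A) c N :
  moment_rec k e ->
  (N + k).+2%:R * umbral c 1 N.+2 e =
  ((N.+1).*2 + k.+1)%:R * umbral c 1 N.+1 e + k%:R * c * umbral c 1 N.+1 e
  + N.+1%:R * (c ^+ 2 - 1) * umbral c 1 N e.
Proof.
move=> He; have := umbral_moment c 1 N.+1 He.
rewrite umbral_absorbl umbral_absorbr !umbralS /=.
set x := umbral _ _ _ e; set y := umbral _ _ _ _; set z := umbral _ _ _ _ => H.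
apply/eqP; rewrite -subr_eq0; apply/eqP.
transitivity (c * (k.+1%:R * (1 * y + c * z) + N.+1%:R * c * z -
  (k%:R * (1 * x + c * y) + N.+1%:R * c * x))); last by rewrite H subrr mulr0.
rewrite -addnn -[(N + k).+2]addn2 -[k.+1]addn1 -[N.+1]addn1 !natrD.
by ring.
Qed.

(** Here D1 and D2 are the complex fields X - iY and X + iY, u = z and v =
    z-bar (or the mirror image, with i replaced by -i).  Both derivatives of
    an umbral power of order N are umbral powers of order N - 1, and a factor
    r = uv raises the order again by absorption; what is left at order N - 1
    is the umbral power of the defect of the moment recursion. *)
Lemma umbral_harmonic (A : comNzRingType) (D1 D2 : A -> A) (i u v t : A)
  (e : nat -> A) (k N : nat) :
  derivation D1 -> derivation D2 ->
  (forall j, D1 (e j) = 0) -> (forall j, D2 (e j) = 0) ->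
  D1 i = 0 -> D2 i = 0 ->
  D1 u = 2 -> D1 v = 0 -> D1 t = 2 * i * v ->
  D2 u = 0 -> D2 v = 2 -> D2 t = - (2 * i * u) ->
  moment_rec k e ->
  let h := u ^+ k * umbral (i * (u * v)) t N e in
  D1 (D2 h) + D2 (D1 h) = 0.
Proof.
move=> d1 d2 e1 e2 i1 i2 u1 v1 t1 u2 v2 t2 He h.
have D1N := d1.1; have D2N := d2.1; have D1M := d1.2; have D2M := d2.2.
pose F M g := umbral (i * (u * v)) t M g.
have a1 : D1 (i * (u * v)) = 2 * i * v by rewrite !D1M i1 u1 v1; ring.
have a2 : D2 (i * (u * v)) = 2 * i * u by rewrite !D2M i2 u2 v2; ring.
pose E1 := F N.-1 e; pose S1 := F N.-1 (fun j => e j.+1).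
pose X0 := F N.-2 e; pose X2 := F N.-2 (fun j => e j.+2).
pose X1 := F N.-2 (fun j => e j.+1).
have D1U M g : (forall j, D1 (g j) = 0) ->
    D1 (F M g) = M%:R * (2 * i * v * (F M.-1 (fun j => g j.+1) + F M.-1 g)).
  by move=> g0; rewrite derivation_umbral // a1 t1 /F; ring.
have D2U M g : (forall j, D2 (g j) = 0) ->
    D2 (F M g) = M%:R * (2 * i * u * (F M.-1 (fun j => g j.+1) - F M.-1 g)).
  by move=> g0; rewrite derivation_umbral // a2 t2 /F; ring.
have D1E : D1 E1 = N.-1%:R * (2 * i * v * (X1 + X0)) by exact: D1U.
have D1S : D1 S1 = N.-1%:R * (2 * i * v * (X2 + X1)).
  by apply: D1U => j; exact: e1.
have D2E : D2 E1 = N.-1%:R * (2 * i * u * (X1 - X0)) by exact: D2U.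
have D2S : D2 S1 = N.-1%:R * (2 * i * u * (X2 - X1)).
  by apply: D2U => j; exact: e2.
have D2F : D2 (F N e) = N%:R * (2 * i * u * (S1 - E1)) by exact: D2U.
have D1F : D1 (F N e) = N%:R * (2 * i * v * (S1 + E1)) by exact: D1U.
have rel : k.+1%:R * S1 + N.-1%:R * (i * (u * v)) * X2 =
           k%:R * E1 + N.-1%:R * (i * (u * v)) * X0.
  have := umbral_moment (i * (u * v)) t N.-1 He.
  by rewrite umbral_absorbl umbral_absorbr.
clearbody E1 S1 X0 X1 X2; clear D1U D2U.
have hE : h = u ^+ k * F N e by [].
clearbody F h.
have D2h : D2 h = N%:R * (2 * i * (u ^+ k.+1 * (S1 + -1 * E1))).
  by rewrite hE D2M derivation_exp // u2 D2F exprS; ring.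
have D1h : D1 h = 2 * (k%:R * (u ^+ k.-1 * F N e))
           + N%:R * (2 * i * (u ^+ k * (v * (S1 + E1)))).
  by rewrite hE D1M derivation_exp // u1 D1F; ring.
have n1 n : D1 n%:R = 0 by exact: derivation_nat.
have n2 n : D2 n%:R = 0 by exact: derivation_nat.
have m1 : D1 (-1) = 0.
  by apply: (addrI (D1 1)); rewrite -D1N subrr addr0 (n1 0%N) (n1 1%N).
have k1 : k%:R * (u ^+ k.-1 * u) = k%:R * u ^+ k.
  by case: (k) => [|k'] /=; rewrite ?exprS; ring.
have pw D : derivation D -> D (u ^+ k.+1) = k.+1%:R * (u ^+ k * D u).
  by move=> dD; rewrite derivation_exp // mulrA.
have DD2 : D1 (D2 h) = N%:R * (2 * i * (k.+1%:R * (u ^+ k * 2) * (S1 + -1 * E1)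
    + u * u ^+ k * (D1 S1 - D1 E1))).
  rewrite D2h D1M n1 (D1M (2 * i)) (D1M 2) (n1 2%N) i1 (D1M _ (S1 + _)) pw //.
  by rewrite u1 D1N (D1M (-1)) m1 exprS; ring.
have DD1 : D2 (D1 h) = 2 * (k%:R * (u ^+ k.-1 * D2 (F N e)))
    + N%:R * (2 * i * (u ^+ k * (2 * (S1 + E1) + v * (D2 S1 + D2 E1)))).
  rewrite D1h D2N (D2M 2) (n2 2%N) (D2M k%:R) n2 (D2M (u ^+ k.-1)).
  rewrite (derivation_exp u k.-1 d2) u2 (D2M N%:R) n2 (D2M (2 * i)) (D2M 2).
  rewrite (n2 2%N) i2 (D2M (u ^+ k)) (derivation_exp u k d2) u2 (D2M v) v2 D2N.
  ring.
rewrite DD1 DD2 D1E D1S D2E D2S D2F.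
move/eqP: rel; rewrite -subr_eq0 => /eqP rel.
transitivity (8 * i * N%:R * u ^+ k *
   (k.+1%:R * S1 + N.-1%:R * (i * (u * v)) * X2 -
    (k%:R * E1 + N.-1%:R * (i * (u * v)) * X0))
   + 4 * N%:R * i * (S1 - E1) * (k%:R * (u ^+ k.-1 * u) - k%:R * u ^+ k));
  last by rewrite rel k1 subrr !mulr0 addr0.
move: (u ^+ k) (u ^+ k.-1) => uk uk1.
rewrite -[k.+1]addn1 natrD.
ring.
Qed.

(** The recursion has order two, so two consecutive moments are computed. *)
Fixpoint moments (F : fieldType) (k n : nat) : F * F :=
  if n is m.+1 then
    let: (a, b) := moments F k m in (b, (k%:R * b + n%:R * a) / (k + n.+1)%:R)
  else (1, k%:R / k.+1%:R).
Definition moment (F : fieldType) k n : F := (moments F k n).1.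

Lemma momentP (F : numFieldType) k : moment_rec k (moment F k).
Proof.
have S1 n : (moments F k n).2 = moment F k n.+1.
  by rewrite /moment /=; case: moments.
case=> [|j].
  rewrite addn1 mul0r addr0 -S1 /= /moment /= mulr1 mulrCA.
  by rewrite divff ?mulr1 ?pnatr_eq0.
rewrite -S1 /= -[moment F k j.+1]S1 /moment; case: moments => a b /=.
by rewrite mulrC divfK // pnatr_eq0 addnS.
Qed.

Lemma int_even_umbral (F : numFieldType) N (f : nat -> F) :
  (forall j, exists z : int, f j = (2 * z)%:~R) ->
  exists z : int, umbral 1 1 N f = (2 * z)%:~R.
Proof.
elim: N f => [|N IH] f Hf; first exact: Hf.
have [z Ez] := IH f Hf; have [y Ey] := IH _ (fun j => Hf j.+1).
by exists (z + y); rewrite umbralS Ez Ey !mul1r -intrD mulrDr.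
Qed.

Lemma int_odd_umbral (F : numFieldType) N (f : nat -> F) :
  f 0%N = 1 -> (forall j, exists z : int, f j.+1 = (2 * z)%:~R) ->
  exists z : int, umbral 1 1 N f = (2 * z + 1)%:~R.
Proof.
move=> f0 Hf; elim: N => [|N [z Ez]]; first by exists 0; rewrite /= f0.
have [y Ey] := int_even_umbral N Hf.
exists (z + y); rewrite umbralS Ez Ey !mul1r -intrD; congr (_%:~R); ring.
Qed.

Lemma central_binS j :
  (j.+1 * 'C(j.+1.*2, j.+1) = 2 * (j.*2.+1 * 'C(j.*2, j)))%N.
Proof.
apply/eqP; rewrite -(eqn_pmul2l (ltn0Sn j)); apply/eqP.
have := mul_bin_diag j.*2.+2 j; rewrite /= doubleS => <-.
have := mul_bin_down j.*2.+1 j.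
have -> : (j.*2.+1 - j = j.+1)%N by rewrite -addnn -addSn addnK.
rewrite /= => ->; rewrite -doubleS -mul2n; nia.
Qed.

(** For k = 0 the odd moments vanish and the even ones are C(2j,j) / 4^j, so
    that with c^2 = -16 all the c^j e_j with j > 0 are even integers while e_0
    = 1. *)
Lemma umbral_moment0_neq0 (F : numFieldType) (c : F) N :
  c ^+ 2 = -16 -> umbral c 1 N (moment F 0) != 0.
Proof.
move=> c2; have He := @momentP F 0.
set e := moment F 0 in He *.
have e0 : e 0%N = 1 by [].
have key j : c ^+ j.*2 * e j.*2 = (-4) ^+ j * 'C(j.*2, j)%:R
          /\ c ^+ j.*2.+1 * e j.*2.+1 = 0.
  elim: j => [|j [IH1 IH2]].
    have /eqP := He 0%N; rewrite !mul0r addr0 mul1r => /eqP e1.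
    by rewrite /= e1 !mulr0 e0 bin0 !mulr1.
  have Ej : j.*2.+2%:R * (c ^+ j.+1.*2 * e j.+1.*2) =
            -16 * (j.*2.+1%:R * (c ^+ j.*2 * e j.*2)).
    have := He j.*2.+1; rewrite add0n mul0r add0r /= => E.
    by rewrite doubleS mulrCA E !exprS mulrA -expr2 c2; ring.
  split.
    apply: (@mulfI _ j.*2.+2%:R); first by rewrite pnatr_eq0.
    rewrite Ej IH1 exprS; have := central_binS j.
    move/(congr1 (fun n : nat => n%:R : F)); rewrite !natrM => E.
    transitivity (-8 * (-4) ^+ j * (2 * (j.*2.+1%:R * 'C(j.*2, j)%:R)) : F).
      by ring.
    by rewrite -E -doubleS -mul2n natrM; ring.
  apply: (@mulfI _ j.+1.*2.+1%:R); first by rewrite pnatr_eq0.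
  have := He j.+1.*2; rewrite add0n mul0r add0r doubleS /= => E.
  rewrite mulrCA E mulr0 !exprS.
  transitivity (c * c * j.*2.+2%:R * (c ^+ j.*2.+1 * e j.*2.+1)).
    by rewrite exprS; ring.
  by rewrite IH2 mulr0.
have [z Ez] : exists z : int, umbral c 1 N e = (2 * z + 1)%:~R.
  rewrite -[c]mulr1 umbral_scalel; apply: int_odd_umbral.
    by rewrite expr0 e0 mulr1.
  move=> j; have [Ke Ko] := key j.+1./2.
  have [jo|je] := boolP (odd j.+1).
    exists 0; have := odd_double_half j.+1; rewrite jo add1n => Ej.
    by rewrite -Ej Ko mulr0.
  have Ej : j.+1 = j.+1./2.*2 by rewrite -[LHS]odd_double_half (negbTE je).
  case: (j.+1./2) Ej Ke => [//|i] -> ->.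
  exists (-2 * (-4) ^+ i * 'C(i.+1.*2, i.+1)%:Z).
  by rewrite !rmorphM rmorphXn /= exprS; ring.
by rewrite Ez intr_eq0; lia.
Qed.

(** Let d_N be the difference of M_(N+1) conj(M_N) and its conjugate, divided
    by c. As c is purely imaginary, the three-term recursion gives
      (N+k+2) d_(N+1) = 2k |M_(N+1)|^2 + 17 (N+1) d_N,
    so that d_N > 0 for all N as soon as k > 0. *)
Lemma umbral_moment_neq0 (C : numClosedFieldType) (c : C) k N :
  (0 < k)%N -> c ^+ 2 = -16 -> c^* = - c -> umbral c 1 N (moment C k) != 0.
Proof.
move=> k0 c2 cc; have He := @momentP C k.
set e := moment C k in He *.
have c0 : c != 0.
  apply/eqP => c0; move/eqP: c2.
  by rewrite c0 expr0n eq_sym oppr_eq0 pnatr_eq0.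
pose M N := umbral c 1 N e.
have M0 : M 0%N = 1 by [].
have M1 : k.+1%:R * M 1%N = k.+1%:R + k%:R * c.
  have := He 0%N; rewrite mul0r addr0 mulr1 addn1 => E.
  rewrite /M umbralS /= -[e 0%N]/(1 : C) mulrDr !mulr1; congr (_ + _).
  by rewrite mulrCA E mulrC.
have M2 N' : (N' + k).+2%:R * M N'.+2 =
  ((N'.+1).*2 + k.+1)%:R * M N'.+1 + k%:R * c * M N'.+1
  - (17 * N'.+1)%:R * M N'.
  by rewrite /M umbral_three_term // c2 natrM; ring.
have <- : M N = umbral c 1 N e by [].
clearbody M.
have M2c N' : (N' + k).+2%:R * (M N'.+2)^* =
  ((N'.+1).*2 + k.+1)%:R * (M N'.+1)^* - k%:R * c * (M N'.+1)^*
  - (17 * N'.+1)%:R * (M N')^*.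
  have cM x y : (x * y)^* = x^* * y^* := rmorphM _ x y.
  have cB x y : (x - y)^* = x^* - y^* := rmorphB _ x y.
  have cD x y : (x + y)^* = x^* + y^* := rmorphD _ x y.
  rewrite -[(N' + k).+2%:R in LHS]conjC_nat -cM M2 cB cD.
  by rewrite !cM !conjC_nat cc mulrN mulNr.
pose d N' := (M N'.+1 * (M N')^* - (M N'.+1)^* * M N') / c.
have d0 : 0 < d 0%N.
  have : 0 < k.+1%:R * d 0%N.
    have -> : k.+1%:R * d 0%N = 2 * k%:R.
      rewrite /d M0 rmorph1 !mulr1 mulrA mulrBr M1.
      rewrite -[k.+1%:R in X in _ - X]conjC_nat -rmorphM M1.
      rewrite rmorphD rmorphM /= !conjC_nat cc; field.
      exact: c0.
    by rewrite mulr_gt0 ?ltr0n.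
  by rewrite pmulr_rgt0 ?ltr0n.
have dS N' : (N' + k).+2%:R * d N'.+1 =
   2 * k%:R * (M N'.+1 * (M N'.+1)^*) + (17 * N'.+1)%:R * d N'.
  rewrite /d; transitivity (((N' + k).+2%:R * M N'.+2 * (M N'.+1)^* -
    (N' + k).+2%:R * (M N'.+2)^* * M N'.+1) / c).
    by move: (M N'.+2)^* (M N'.+1)^* => x y; field; exact: c0.
  by rewrite M2 M2c; field; exact: c0.
have dpos N' : 0 < d N'.
  elim: N' => [//|N' IH].
  have : 0 < (N' + k).+2%:R * d N'.+1.
    rewrite dS ltr_wpDl //; last by rewrite mulr_gt0 // ltr0n.
    by rewrite mulr_ge0 ?mul_conjC_ge0 // mulr_ge0 ?ler0n.
  by rewrite pmulr_rgt0 ?ltr0n.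
apply/eqP => MN; have := dpos N.
by rewrite /d MN conjC0 mulr0 mulr0 subrr mul0r ltxx.
Qed.

(** * Homogeneity read off the coefficients *)

Local Open Scope complex_scope.

Lemma big_ord3 (T : Type) (idx : T) (op : Monoid.law idx) (F : 'I_3 -> T) :
  \big[op/idx]_i F i = op (op (F (inord 0)) (F (inord 1))) (F (inord 2)).
Proof.
rewrite !big_ord_recl big_ord0 Monoid.mulm1 Monoid.mulmA.
by congr (op (op (F _) (F _)) (F _)); apply: val_inj; rewrite /= inordK.
Qed.

Definition weight (k : multinom 3) : nat :=
  (k (inord 0) + k (inord 1) + 2 * k (inord 2))%N.

Lemma mpolyX3 (R : realType) (k : multinom 3) :
  mpolyX R[i] k = xX ^+ k (inord 0) * yX ^+ k (inord 1) * tX ^+ k (inord 2).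
Proof. by rewrite mpolyXE_id big_ord3. Qed.

Lemma hevalE (R : realType) (p : hpoly R) (x y t : R) :
  heval p (x, y, t) = \sum_(k <- msupp p) mcoeff k p *
    (real_complex R x ^+ k (inord 0) * real_complex R y ^+ k (inord 1) *
     real_complex R t ^+ k (inord 2)).
Proof.
rewrite /heval mevalE; apply: eq_bigr => k _; rewrite big_ord3.
by rewrite !(tnth_nth 0) !inordK.
Qed.

Lemma heval_xX (R : realType) (x y t : R) :
  heval xX (x, y, t) = real_complex R x.
Proof. by rewrite /heval mevalXU (tnth_nth 0) inordK. Qed.
Lemma heval_yX (R : realType) (x y t : R) :
  heval yX (x, y, t) = real_complex R y.
Proof. by rewrite /heval mevalXU (tnth_nth 0) inordK. Qed.
Lemma heval_tX (R : realType) (x y t : R) :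
  heval tX (x, y, t) = real_complex R t.
Proof. by rewrite /heval mevalXU (tnth_nth 0) inordK. Qed.
Lemma hevalM (R : realType) (p q : hpoly R) a :
  heval (p * q) a = heval p a * heval q a.
Proof. by case: a => [[x y] t]; rewrite /heval mevalM. Qed.
Lemma hevalD (R : realType) (p q : hpoly R) a :
  heval (p + q) a = heval p a + heval q a.
Proof. by case: a => [[x y] t]; rewrite /heval mevalD. Qed.
Lemma hevalC (R : realType) c a : heval (mpolyC 3 c : hpoly R) a = c.
Proof. by case: a => [[x y] t]; rewrite /heval mevalC. Qed.

Lemma poly_natr_eq0 (F : numDomainType) (q : {poly F}) :
  (forall n : nat, q.[n%:R] = 0) -> q = 0.
Proof.
move=> q0; pose s := [seq n%:R : F | n <- iota 0 (size q)].
apply: (@roots_geq_poly_eq0 _ q s).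
- by apply/allP => _ /mapP[n _ ->]; rewrite /root q0.
- rewrite map_inj_uniq ?iota_uniq // => m n /eqP.
  by rewrite eqr_nat => /eqP.
- by rewrite size_map size_iota.
Qed.

Lemma kronecker_inj (d a b c a' b' c' : nat) :
  (a < d -> b < d -> c < d -> a' < d -> b' < d -> c' < d ->
  a + d * (b + d * c) = a' + d * (b' + d * c') ->
  [/\ a = a', b = b' & c = c'])%N.
Proof.
have dm x y x' y' : (x < d -> x' < d ->
    x + d * y = x' + d * y' -> x = x' /\ y = y')%N.
  move=> xd xd' E; have d0 : (0 < d)%N by exact: leq_ltn_trans xd.
  have := congr1 (modn^~ d) E.
  rewrite /= ![(_ + d * _)%N]addnC ![(d * _)%N]mulnC.
  rewrite !modnMDl !modn_small // => xx; split=> //.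
  by move: E; rewrite xx => /addnI /eqP; rewrite eqn_pmul2l // => /eqP.
move=> ad bd cd ad' bd' cd' /(dm _ _ _ _ ad ad')[->].
by move=> /(dm _ _ _ _ bd bd')[-> ->].
Qed.

Lemma exponent_lt_msize (R : realType) (p : hpoly R) k i :
  k \in msupp p -> (k i < msize p)%N.
Proof.
move=> kp; apply: leq_ltn_trans (msize_mdeg_lt kp).
by rewrite mdegE (bigD1 i) //= leq_addr.
Qed.

Lemma multinom3P (k l : multinom 3) : k (inord 0) = l (inord 0) ->
  k (inord 1) = l (inord 1) -> k (inord 2) = l (inord 2) -> k = l.
Proof.
move=> e0 e1 e2; apply/mnmP => i.
have : i \in [:: inord 0; inord 1; inord 2].
  case: i => -[|[|[|//]]] Hi; rewrite !inE -!val_eqE /= !inordK //.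
by rewrite !inE => /or3P[] /eqP ->.
Qed.

(** The Kronecker substitution (x,y,t) = (s, s^d, s^(d^2)), with d larger than
    all exponents, sends distinct monomials of p to distinct powers of s.
    Applied to the identity p(dil 2 a) = 2^n p(a) it yields a polynomial in s
    with infinitely many roots, and hence 2^weight = 2^n for each monomial of
    p. *)
Lemma PhomP (R : realType) (m : int) (p : hpoly R) :
  Phom m p <-> forall k, mcoeff k p != 0 -> (weight k)%:Z = m.
Proof.
case: m => n; last first.
  split=> [-> k|H]; first by rewrite mcoeff0 eqxx.
  by apply/mpolyP => k; rewrite mcoeff0; apply/eqP; apply: contraT => /H.
split=> [H k k0|H r r0 [[x y] t]]; last first.
  rewrite hevalE [dil _ _]/= hevalE mulr_sumr; apply: eq_big_seq => k.
  rewrite mcoeff_msupp => /H; rewrite /weight => -[<-].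
  rewrite !rmorphM /= [_ ^+ (_ + 2 * _)]exprD exprM expr2 exprD !exprMn.
  by ring.
pose d := msize p.
pose kap (l : multinom 3) :=
  (l (inord 0) + d * (l (inord 1) + d * l (inord 2)))%N.
pose c (l : multinom 3) := mcoeff l p * ((2 : R[i]) ^+ weight l - 2 ^+ n).
pose Q := \sum_(l <- msupp p) c l *: 'X^(kap l).
have kp : k \in msupp p by rewrite mcoeff_msupp.
have Q0 : Q = 0.
  apply: poly_natr_eq0 => s; rewrite /Q horner_sum.
  have := H 2 (ltr0n _ 2) (s%:R, s%:R ^+ d, s%:R ^+ (d * d)).
  move/eqP; rewrite -subr_eq0 => /eqP; apply: etrans.
  rewrite [dil _ _]/= !hevalE mulr_sumr -sumrB; apply: eq_bigr => l _.
  rewrite hornerZ hornerXn /c /weight /kap.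
  have cM x y : real_complex R (x * y) = real_complex R x * real_complex R y.
    exact: rmorphM.
  have cX x i : real_complex R (x ^+ i) = real_complex R x ^+ i.
    exact: rmorphXn.
  have cn i : real_complex R i%:R = i%:R by exact: rmorph_nat.
  have -> : (2 : R[i]) ^+ (l (inord 0) + l (inord 1) + 2 * l (inord 2)) =
      2 ^+ l (inord 0) * 2 ^+ l (inord 1) * (2 * 2) ^+ l (inord 2).
    by rewrite exprD exprM exprD expr2.
  rewrite mulnDr mulnA exprD [_ ^+ (d * _ + _)]exprD !cM !cX !cn !exprMn.
  rewrite (exprM _ d) (exprM _ (d * d)); ring.
have := congr1 (fun q : {poly R[i]} => q`_(kap k)) Q0.
rewrite coef0 coef_sum (bigD1_seq k) //= ?msupp_uniq // coefZ coefXn eqxx mulr1.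
rewrite big_seq_cond big1 ?addr0; last first.
  move=> l /andP[lp lk]; rewrite coefZ coefXn.
  case: eqP => [E|]; last by rewrite mulr0.
  case/negP: lk; apply/eqP.
  by case: (kronecker_inj _ _ _ _ _ _ E); try exact: exponent_lt_msize => //;
    move=> *; apply: multinom3P.
move/eqP; rewrite /c mulf_eq0 (negbTE k0) /= subr_eq0 -!natrX eqr_nat.
by rewrite eqn_exp2l // => /eqP ->.
Qed.

(** * Homogeneous polynomials *)

Local Notation constp c := (mpolyC 3 c).

Lemma Phom0 (R : realType) (m : int) : Phom m (0 : hpoly R).
Proof. by apply/PhomP => k; rewrite mcoeff0 eqxx. Qed.

Lemma PhomD (R : realType) (m : int) (p q : hpoly R) :
  Phom m p -> Phom m q -> Phom m (p + q).
Proof.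
move=> /PhomP Hp /PhomP Hq; apply/PhomP => k.
have [p0|/Hp//] := eqVneq (mcoeff k p) 0.
by rewrite mcoeffD p0 add0r => /Hq.
Qed.

Lemma PhomC (R : realType) (c : R[i]) : Phom 0 (constp c : hpoly R).
Proof. by move=> r _ a; rewrite !hevalC mul1r. Qed.

Arguments PhomC R c : clear implicits.

Lemma PhomM (R : realType) (m n : int) (p q : hpoly R) :
  Phom m p -> Phom n q -> Phom (m + n) (p * q).
Proof.
case: m => m; last by move=> -> _; rewrite mul0r; exact: Phom0.
case: n => n; last by move=> _ ->; rewrite mulr0; exact: Phom0.
move=> Hp Hq; change (Phom (Posz (m + n)) (p * q)) => r r0 a.
by rewrite !hevalM Hp // Hq // exprD mulrACA.
Qed.

Lemma Phom_exp (R : realType) (m : int) (p : hpoly R) n :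
  Phom m p -> Phom (m * n%:Z) (p ^+ n).
Proof.
move=> Hp; elim: n => [|n IH].
  by rewrite mulr0 expr0 -mpolyC1; exact: PhomC.
by rewrite exprS intS mulrDr mulr1; exact: PhomM.
Qed.

Lemma PhomZ (R : realType) (m : int) c (p : hpoly R) :
  Phom m p -> Phom m (constp c * p).
Proof. by move=> Hp; rewrite -[m]add0r; apply: PhomM (PhomC R c) Hp. Qed.

Lemma PhomB (R : realType) (m : int) (p q : hpoly R) :
  Phom m p -> Phom m q -> Phom m (p - q).
Proof.
move=> Hp Hq; apply: PhomD => //.
by rewrite -mulN1r -mpolyC1 -mpolyCN; exact: PhomZ.
Qed.

Lemma Phom_xX (R : realType) : Phom 1 (xX : hpoly R).
Proof. by move=> r _ [[x y] t]; rewrite /dil !heval_xX rmorphM. Qed.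
Lemma Phom_yX (R : realType) : Phom 1 (yX : hpoly R).
Proof. by move=> r _ [[x y] t]; rewrite /dil !heval_yX rmorphM. Qed.
Lemma Phom_tX (R : realType) : Phom 2 (tX : hpoly R).
Proof. by move=> r _ [[x y] t]; rewrite /dil !heval_tX rmorphM rmorphXn. Qed.

Arguments Phom_xX R : clear implicits.
Arguments Phom_yX R : clear implicits.
Arguments Phom_tX R : clear implicits.

Lemma Phom_mderiv (R : realType) (m : int) (p : hpoly R) i :
  Phom m p -> Phom (m - (weight (mnm1 i))%:Z) (mderiv i p).
Proof.
move=> /PhomP Hp; apply/PhomP => k; rewrite mcoeff_deriv => Hk.
have /Hp <- : mcoeff (mnm_add k (mnm1 i)) p != 0.
  by apply: contraNneq Hk => ->; rewrite mul0rn.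
rewrite /weight !mnmDE; lia.
Qed.

Lemma Phom_dx (R : realType) (m : int) (p : hpoly R) :
  Phom m p -> Phom (m - 1) (dx p).
Proof.
move/(@Phom_mderiv _ _ _ (inord 0)); congr (Phom (_ - _) _).
by rewrite /weight !mnm1E -!val_eqE /= !inordK.
Qed.
Lemma Phom_dy (R : realType) (m : int) (p : hpoly R) :
  Phom m p -> Phom (m - 1) (dy p).
Proof.
move/(@Phom_mderiv _ _ _ (inord 1)); congr (Phom (_ - _) _).
by rewrite /weight !mnm1E -!val_eqE /= !inordK.
Qed.
Lemma Phom_dt (R : realType) (m : int) (p : hpoly R) :
  Phom m p -> Phom (m - 2) (dt p).
Proof.
move/(@Phom_mderiv _ _ _ (inord 2)); congr (Phom (_ - _) _).
by rewrite /weight !mnm1E -!val_eqE /= !inordK.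
Qed.

Lemma Phom_fieldX (R : realType) (m : int) (p : hpoly R) :
  Phom m p -> Phom (m - 1) (fieldX p).
Proof.
move=> Hp; apply: PhomD; first exact: Phom_dx.
rewrite (_ : m - 1 = 0 + 1 + (m - 2)); last by lia.
refine (@PhomM _ (0 + 1) (m - 2) (2 * yX) _ _ (Phom_dt Hp)).
by rewrite -(mpolyC_nat 3 R[i] 2); exact: (PhomM (PhomC R _) (Phom_yX R)).
Qed.
Lemma Phom_fieldY (R : realType) (m : int) (p : hpoly R) :
  Phom m p -> Phom (m - 1) (fieldY p).
Proof.
move=> Hp; apply: PhomB; first exact: Phom_dy.
rewrite (_ : m - 1 = 0 + 1 + (m - 2)); last by lia.
refine (@PhomM _ (0 + 1) (m - 2) (2 * xX) _ _ (Phom_dt Hp)).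
by rewrite -(mpolyC_nat 3 R[i] 2); exact: (PhomM (PhomC R _) (Phom_xX R)).
Qed.

Lemma Phom_subLaplacian (R : realType) (m : int) (p : hpoly R) :
  Phom m p -> Phom (m - 2) (subLaplacian p).
Proof.
move=> Hp; rewrite (_ : m - 2 = m - 1 - 1); last by lia.
by apply: PhomD; [do 2!apply: Phom_fieldX | do 2!apply: Phom_fieldY].
Qed.

Lemma mderiv_derivation (R : realType) (i : 'I_3) :
  derivation (mderiv i : hpoly R -> hpoly R).
Proof. by split=> p q; [exact: mderivD | exact: mderivM]. Qed.

Lemma fieldX_derivation (R : realType) : derivation (@fieldX R).
Proof.
exact: derivation_comb (mderiv_derivation R _) (mderiv_derivation R _).
Qed.

Lemma fieldY_derivation (R : realType) : derivation (@fieldY R).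
Proof.
have [D M] := derivation_comb (- (2 * xX))
  (mderiv_derivation R (inord 1)) (mderiv_derivation R (inord 2)).
have E p : fieldY p = dy p + - (2 * xX) * dt p :> hpoly R by rewrite mulNr.
by split=> p q; rewrite !E; [exact: D | exact: M].
Qed.

Lemma fieldXC (R : realType) c : @fieldX R (constp c) = 0.
Proof. by rewrite /fieldX /dx /dt !mderivC mulr0 addr0. Qed.
Lemma fieldYC (R : realType) c : @fieldY R (constp c) = 0.
Proof. by rewrite /fieldY /dy /dt !mderivC mulr0 subr0. Qed.

Lemma mderivU (R : realType) (i j : 'I_3) :
  mderiv i (mpolyX R[i] (mnm1 j)) = (i == j)%:R.
Proof.
rewrite mderivX mnm1E eq_sym; case: eqP => [->|_]; last by rewrite scale0r.
rewrite (_ : mnm_sub (mnm1 j) (mnm1 j) = mnm0) ?mpolyX0 ?scale1r //.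
by apply/mnmP => l; rewrite mnmBE subnn mnm0E.
Qed.

Lemma field_coord (R : realType) :
  (@fieldX R xX = 1) * (@fieldX R yX = 0) * (@fieldX R tX = 2 * yX) *
  (@fieldY R xX = 0) * (@fieldY R yX = 1) * (@fieldY R tX = - (2 * xX)).
Proof.
rewrite /fieldX /fieldY /dx /dy /dt /xX /yX /tX !mderivU -!val_eqE /=.
rewrite !inordK //=.
by do !split; ring.
Qed.

(** For c = i, [zeta c] is z and [horizontal c] is X + iY, for c = -i their
    conjugates; carrying c along treats both cases at once. *)
Definition zeta {R : realType} (c : R[i]) : hpoly R := xX + constp c * yX.
Definition horizontal {R : realType} (c : R[i]) (p : hpoly R) :=
  fieldX p + constp c * fieldY p.

Lemma sqr_const (R : realType) (c : R[i]) :
  c ^+ 2 = -1 -> constp c * constp c = -1 :> hpoly R.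
Proof. by move=> c2; rewrite -mpolyCM -expr2 c2 mpolyCN mpolyC1. Qed.

Lemma horizontal_derivation (R : realType) (c : R[i]) :
  derivation (horizontal c).
Proof.
exact: derivation_comb (fieldX_derivation R) (fieldY_derivation R).
Qed.

Lemma horizontalC (R : realType) (c : R[i]) d : horizontal c (constp d) = 0.
Proof. by rewrite /horizontal fieldXC fieldYC mulr0 addr0. Qed.

Lemma horizontal_coord (R : realType) (c : R[i]) : c ^+ 2 = -1 ->
  [/\ horizontal c (zeta (- c)) = 2, horizontal c (zeta c) = 0
    & horizontal c tX = - (2 * constp c * zeta c)].
Proof.
move=> /sqr_const; have [XD XM] := fieldX_derivation R.
have [YD YM] := fieldY_derivation R.
rewrite /horizontal /zeta mpolyCN !(XD, YD) !(XM, YM) !field_coord.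
rewrite !(derivationN _ (fieldX_derivation R)).
rewrite !(derivationN _ (fieldY_derivation R)).
rewrite !(fieldXC, fieldYC); move: (constp c) (@xX R) (@yX R) => d x y dd.
by split; ring: dd.
Qed.

Lemma subLaplacianE (R : realType) (c : R[i]) (p : hpoly R) : c ^+ 2 = -1 ->
  2 * subLaplacian p =
  horizontal (- c) (horizontal c p) + horizontal c (horizontal (- c) p).
Proof.
move=> /sqr_const cc; rewrite /horizontal mpolyCN.
exact: (@sum_of_squares_derivation _ _ _ _ p (fieldX_derivation R)
  (fieldY_derivation R) (@fieldXC R c) (@fieldYC R c) cc).
Qed.

(** * Harmonic polynomials and decomposition modulo w *)

Lemma two_neq0 (R : realType) : (2 : hpoly R) != 0.
Proof. by rewrite -(mpolyC_nat 3 R[i] 2) mpolyC_eq0 pnatr_eq0. Qed.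

Lemma subLaplacianD (R : realType) : {morph @subLaplacian R : p q / p + q}.
Proof.
exact: sum_of_squaresD (fieldX_derivation R) (fieldY_derivation R).
Qed.

Lemma subLaplacianC (R : realType) c (p : hpoly R) :
  subLaplacian (constp c * p) = constp c * subLaplacian p.
Proof.
exact: (sum_of_squaresZ p (fieldX_derivation R) (fieldY_derivation R)
  (fieldXC c) (fieldYC c)).
Qed.

Lemma subLaplacian0 R : @subLaplacian R 0 = 0.
Proof.
rewrite -[X in subLaplacian X](mulr0 (constp 0)) subLaplacianC.
by rewrite mpolyC0 mul0r.
Qed.

Lemma moment_rec_const (R : realType) k :
  moment_rec k (fun j => constp (moment R[i] k j)).
Proof. by move=> j; rewrite -!mpolyC_nat -!mpolyCM -mpolyCD momentP. Qed.

(** For c = i this is z^k E[(t + irs)^N]; for c = -i, its mirror image. *)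
Definition axial {R : realType} (c : R[i]) k N : hpoly R :=
  zeta c ^+ k * umbral (constp c * (zeta c * zeta (- c))) tX N
    (fun j => constp (moment R[i] k j)).

Lemma axial_harmonic (R : realType) (c : R[i]) k N :
  c ^+ 2 = -1 -> subLaplacian (axial c k N) = 0.
Proof.
move=> c2; have c2N : (- c) ^+ 2 = -1 by rewrite sqrrN.
have [z1 z2 z3] := horizontal_coord c2; have := horizontal_coord c2N.
rewrite opprK => -[w1 w2 w3].
apply: (mulfI (two_neq0 R)); rewrite (subLaplacianE _ c2) mulr0.
have w3' : horizontal (- c) tX = 2 * constp c * zeta (- c).
  by rewrite w3 mpolyCN mulrN mulNr opprK.
exact: (@umbral_harmonic _ (horizontal (- c)) (horizontal c) (constp c) (zeta c)
  (zeta (- c)) tX (fun j => constp (moment R[i] k j)) k N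
  (horizontal_derivation _) (horizontal_derivation _)
  (fun j => horizontalC _ _) (fun j => horizontalC _ _)
  (horizontalC _ _) (horizontalC _ _)
  w1 w2 w3' z2 z1 z3 (moment_rec_const R k)).
Qed.

Lemma Phom_umbral (R : realType) (a b : hpoly R) f N :
  Phom 2 a -> Phom 2 b -> (forall j, Phom 0 (f j)) ->
  Phom (N%:Z *+ 2) (umbral a b N f).
Proof.
move=> Ha Hb; elim: N f => [|N IH] f Hf; first exact: Hf.
rewrite umbralS (_ : N.+1%:Z *+ 2 = 2 + N%:Z *+ 2); last by lia.
by apply: PhomD; apply: PhomM => //; apply: IH.
Qed.

Lemma umbral_subr (R : realType) (a b b' : hpoly R) f N :
  Phom 2 a -> Phom 2 b -> Phom 2 b' -> (forall j, Phom 0 (f j)) ->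
  exists2 q, Phom (N%:Z *+ 2 - 2) q &
    umbral a b N f = umbral a b' N f + (b - b') * q.
Proof.
move=> Ha Hb Hb'; elim: N f => [|N IH] f Hf.
  by exists 0; [exact: Phom0 | rewrite mulr0 addr0].
have [q1 Hq1 E1] := IH f Hf; have [q2 Hq2 E2] := IH _ (fun j => Hf j.+1).
exists (umbral a b N f + b' * q1 + a * q2); last first.
  rewrite !umbralS E2 E1; move: (umbral _ _ _ _) (umbral _ _ _ _) => x y; ring.
have e : N.+1%:Z *+ 2 - 2 = N%:Z *+ 2 by lia.
have e' : N.+1%:Z *+ 2 - 2 = 2 + (N%:Z *+ 2 - 2) by lia.
apply: PhomD; first apply: PhomD.
- by rewrite e; exact: Phom_umbral.
- by rewrite e'; exact: PhomM.
- by rewrite e'; exact: PhomM.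
Qed.

Definition decomposable {R : realType} (m : int) (p : hpoly R) :=
  exists h q, [/\ Phom m h, subLaplacian h = 0, Phom (m - 2) q
                & p = h + wpoly * q].

Lemma decomposableD (R : realType) (m : int) (p p' : hpoly R) :
  decomposable m p -> decomposable m p' -> decomposable m (p + p').
Proof.
move=> [h [q [Hh Lh Hq ->]]] [h' [q' [Hh' Lh' Hq' ->]]].
exists (h + h'), (q + q'); split; [exact: PhomD | | exact: PhomD | ].
  by rewrite subLaplacianD Lh Lh' addr0.
by rewrite mulrDr addrACA.
Qed.

Lemma decomposableC (R : realType) (m : int) c (p : hpoly R) :
  decomposable m p -> decomposable m (constp c * p).
Proof.
move=> [h [q [Hh Lh Hq ->]]].
exists (constp c * h), (constp c * q).
split; [exact: PhomZ | | exact: PhomZ | ].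
  by rewrite subLaplacianC Lh mulr0.
by rewrite mulrDr mulrCA.
Qed.

Lemma wpolyE (R : realType) (c : R[i]) : c ^+ 2 = -1 ->
  wpoly = zeta c * zeta (- c) + 4 * tX.
Proof.
move=> /sqr_const; rewrite /wpoly /zeta mpolyCN.
by move: (constp c) (@xX R) (@yX R) (@tX R) => d x y t dd; ring: dd.
Qed.

Lemma Phom_zeta (R : realType) (c : R[i]) : Phom 1 (zeta c).
Proof. apply: PhomD; [exact: Phom_xX | apply: PhomZ; exact: Phom_yX]. Qed.
Arguments Phom_zeta R c : clear implicits.

Lemma umbral_moment_i_neq0 (R : realType) (c : R[i]) k N :
  c ^+ 2 = -1 -> conjc c = - c -> umbral (- 4 * c) 1 N (moment R[i] k) != 0.
Proof.
move=> c2 cc; have c2' : (- 4 * c) ^+ 2 = -16 by rewrite exprMn c2; ring.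
case: k => [|k]; first exact: umbral_moment0_neq0.
apply: umbral_moment_neq0 => //.
by rewrite rmorphM rmorphN rmorph_nat /= [X in _ * X]cc mulrN.
Qed.

(** The harmonic polynomial [axial c k N] is congruent to a nonzero multiple
    of the monomial, because t + r/4 = w/4. *)
Lemma decomposable_power (R : realType) (c : R[i]) k N :
  c ^+ 2 = -1 -> conjc c = - c ->
  decomposable (k%:Z + N%:Z *+ 2) (zeta c ^+ k * (zeta c * zeta (- c)) ^+ N).
Proof.
move=> c2 cc.
have Huv : Phom 2 (zeta c * zeta (- c)).
  exact: (PhomM (Phom_zeta R c) (Phom_zeta R (- c))).
have Huk : Phom k%:Z (zeta c ^+ k).
  by rewrite -[k%:Z]mul1r; apply: Phom_exp; exact: Phom_zeta.
pose l : R[i] := (- 4^-1) ^+ N * umbral (- 4 * c) 1 N (moment R[i] k).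
have l0 : l != 0.
  rewrite mulf_neq0 ?umbral_moment_i_neq0 //.
  by rewrite expf_neq0 ?oppr_eq0 ?invr_eq0 ?pnatr_eq0.
have Hf j : Phom 0 (constp (moment R[i] k j) : hpoly R) := PhomC R _.
have [q Hq E] :=
  umbral_subr N (PhomZ c Huv) (Phom_tX R) (PhomZ (- 4^-1) Huv) Hf.
have El : umbral (constp c * (zeta c * zeta (- c)))
    (constp (- 4^-1) * (zeta c * zeta (- c))) N
    (fun j => constp (moment R[i] k j)) = constp l * (zeta c * zeta (- c)) ^+ N.
  rewrite ![_ * (zeta c * _)]mulrC umbral_scale mulrC; congr (_ * _).
  have <- := @rmorph_umbral R[i] (hpoly R) (@mpolyC 3 R[i]) c (- 4^-1) N
    (moment R[i] k).
  rewrite /l -umbral_scale mulr1.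
  by rewrite mulrA mulrNN mulVf ?pnatr_eq0 // mul1r.
have -> : zeta c ^+ k * (zeta c * zeta (- c)) ^+ N =
    constp l^-1 * (zeta c ^+ k * (constp l * (zeta c * zeta (- c)) ^+ N)).
  by rewrite [RHS]mulrCA [constp l^-1 * _]mulrA -mpolyCM mulVf // mpolyC1 mul1r.
apply: decomposableC; rewrite -El.
exists (axial c k N), (constp (- 4^-1) * (zeta c ^+ k * q)); split.
- apply: PhomM Huk _; apply: Phom_umbral => //; [exact: PhomZ | exact: Phom_tX].
- exact: axial_harmonic.
- by rewrite -addrA; apply: PhomZ; exact: PhomM.
have e4 : 4 * constp (- 4^-1) = -1 :> hpoly R.
  rewrite -(mpolyC_nat 3 R[i] 4) -mpolyCM mulrN divff ?pnatr_eq0 //.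
  by rewrite mpolyCN mpolyC1.
rewrite /axial E (wpolyE c2) {E El}.
have key (A u r t d : hpoly R) : 4 * d = -1 ->
    u * A = u * (A + (t - d * r) * q) + (r + 4 * t) * (d * (u * q)).
  by move=> d4; ring: d4.
exact: key.
Qed.

(** Induction on c, replacing one factor t = w/4 - r/4 at a time. *)
Lemma decomposable_monomial (R : realType) (i : R[i]) a b c :
  i ^+ 2 = -1 -> conjc i = - i ->
  decomposable (a + b + 2 * c)%N%:Z (zeta i ^+ a * zeta (- i) ^+ b * tX ^+ c).
Proof.
move=> i2 ic; elim: c a b => [|c IH] a b.
  rewrite expr0 mulr1; have [ba|/ltnW ab] := leqP b a.
    have := decomposable_power (a - b) b i2 ic.
    rewrite exprMn mulrA -exprD subnK //; congr (decomposable _ _); lia.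
  have i2' : (- i) ^+ 2 = -1 by rewrite sqrrN.
  have ic' : conjc (- i) = - (- i) by rewrite rmorphN /= [conjc i]ic.
  have := decomposable_power (b - a) a i2' ic'.
  rewrite opprK exprMn mulrA -exprD subnK // mulrC.
  by congr (decomposable _ _); lia.
have e4 : 4 * constp (4^-1) = 1 :> hpoly R.
  by rewrite -(mpolyC_nat 3 R[i] 4) -mpolyCM divff ?pnatr_eq0 // mpolyC1.
have -> : zeta i ^+ a * zeta (- i) ^+ b * tX ^+ c.+1 =
  constp (- 4^-1) * (zeta i ^+ a.+1 * zeta (- i) ^+ b.+1 * tX ^+ c) +
  wpoly * (constp 4^-1 * (zeta i ^+ a * zeta (- i) ^+ b * tX ^+ c)).
  rewrite (wpolyE i2) !exprS mpolyCN.
  move: (zeta i) (zeta (- i)) (_ ^+ a) (_ ^+ b) (@tX R) (_ ^+ c).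
  move: (constp 4^-1) e4 => d e4 z zb za zbb t tc.
  by ring: e4.
apply: decomposableD.
  apply: decomposableC; have := IH a.+1 b.+1; congr (decomposable _ _); lia.
exists 0, (constp 4^-1 * (zeta i ^+ a * zeta (- i) ^+ b * tX ^+ c)); split.
- exact: Phom0.
- exact: subLaplacian0.
- apply: PhomZ.
  have -> : (a + b + 2 * c.+1)%N%:Z - 2 = 1 * a%:Z + 1 * b%:Z + 2 * c%:Z by lia.
  by apply: PhomM; [apply: PhomM|]; apply: Phom_exp;
    [exact: Phom_zeta | exact: Phom_zeta | exact: Phom_tX].
- by rewrite add0r.
Qed.

(** * Bijectivity of q |-> Lap(w q) *)

(** The monomials in z, z-bar and t span P_n.  To avoid a change of variables
    in the polynomial ring, the factors x = (z + zbar)/2 and y = (z -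
    zbar)/(2i) of a monomial are traded one by one. *)
Lemma Phom_span (R : realType) (i : R[i]) (K : hpoly R -> Prop) (n : nat) :
  i ^+ 2 = -1 ->
  K 0 -> (forall p q, K p -> K q -> K (p + q)) ->
  (forall c p, K p -> K (constp c * p)) ->
  (forall a b c, (a + b + 2 * c)%N = n ->
     K (zeta i ^+ a * zeta (- i) ^+ b * tX ^+ c)) ->
  forall p, Phom n%:Z p -> K p.
Proof.
move=> i2 K0 KD KC Kmon.
have ci := sqr_const i2.
have half : 2 * constp 2^-1 = 1 :> hpoly R.
  by rewrite -(mpolyC_nat 3 R[i] 2) -mpolyCM divff ?pnatr_eq0 // mpolyC1.
have Ex : xX = constp 2^-1 * zeta i + constp 2^-1 * zeta (- i).
  rewrite /zeta mpolyCN.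
  move: (constp i) (constp 2^-1) (@xX R) (@yX R) half ci.
  by move=> e h x y eh ee; ring: eh.
have Ey : yX = constp (- (i / 2)) * zeta i + constp (i / 2) * zeta (- i).
  rewrite /zeta !mpolyCN mpolyCM.
  move: (constp i) (constp 2^-1) (@xX R) (@yX R) half ci.
  by move=> e h x y eh ee; ring: eh ee.
have gen a b al be c : (a + b + al + be + 2 * c)%N = n ->
    K (xX ^+ a * yX ^+ b * (zeta i ^+ al * zeta (- i) ^+ be * tX ^+ c)).
  elim: a b al be => [|a IHa].
    elim=> [|b IHb] al be E; first by rewrite !expr0 !mul1r; apply: Kmon; lia.
    have := IHb al.+1 be; have := IHb al be.+1; rewrite !expr0 !mul1r.
    move=> /(_ _)/(KC (i / 2))-K1 /(_ _)/(KC (- (i / 2)))-K2.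
    have := KD _ _ (K2 _) (K1 _).
    have key (x1 x2 z w Y A B T : hpoly R) :
      x1 * (Y * (z * A * B * T)) + x2 * (Y * (A * (w * B) * T)) =
      (x1 * z + x2 * w) * Y * (A * B * T) by ring.
    rewrite !exprS key -Ey; apply; lia.
  move=> b al be E.
  have := IHa b al.+1 be; have := IHa b al be.+1.
  move=> /(_ _)/(KC 2^-1)-K1 /(_ _)/(KC 2^-1)-K2.
  have := KD _ _ (K2 _) (K1 _).
  have key (x1 x2 z w X Y A B T : hpoly R) :
      x1 * (X * Y * (z * A * B * T)) + x2 * (X * Y * (A * (w * B) * T)) =
      (x1 * z + x2 * w) * X * Y * (A * B * T) by ring.
  rewrite !exprS key -Ex; apply; lia.
move=> p /PhomP Hp; rewrite [p]mpolyE big_seq.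
apply: (big_ind K) => // k; rewrite mcoeff_msupp => /Hp[Hk].
rewrite -mul_mpolyC; apply: KC; rewrite mpolyX3.
have := gen (k (inord 0)) (k (inord 1)) 0%N 0%N (k (inord 2)).
by rewrite !expr0 !mul1r; apply; move: Hk; rewrite /weight; lia.
Qed.

Lemma sqr_i_eqN1 (R : realType) : ('i : R[i]) ^+ 2 = -1.
Proof. exact: sqr_i. Qed.
Lemma conjc_i (R : realType) : conjc ('i : R[i]) = - 'i.
Proof. by rewrite /conjc; congr Complex; rewrite oppr0. Qed.

Lemma Phom_decomposable (R : realType) (n : nat) (p : hpoly R) :
  Phom n%:Z p -> decomposable n%:Z p.
Proof.
apply: (Phom_span (sqr_i_eqN1 R)).
- exists 0, 0; split; [exact: Phom0 | exact: subLaplacian0 | exact: Phom0 |].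
  by rewrite mulr0 addr0.
- exact: decomposableD.
- exact: decomposableC.
- by move=> a b c <-; apply: decomposable_monomial (sqr_i_eqN1 R) (conjc_i R).
Qed.

Lemma subLaplacian_monomial (R : realType) (i : R[i]) a b c : i ^+ 2 = -1 ->
  subLaplacian (zeta i ^+ a.+1 * zeta (- i) ^+ b.+1 * tX ^+ c) =
  4 * a.+1%:R * b.+1%:R * (zeta i ^+ a * zeta (- i) ^+ b * tX ^+ c)
  - 4 * constp i * (a%:R - b%:R) *
     (c%:R * (zeta i ^+ a.+1 * zeta (- i) ^+ b.+1 * tX ^+ c.-1))
  + 4 * (c%:R * c.-1%:R * (zeta i ^+ a.+2 * zeta (- i) ^+ b.+2 * tX ^+ c.-2)).
Proof.
move=> i2; have i2N : (- i) ^+ 2 = -1 by rewrite sqrrN.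
have [z1 z2 z3] := horizontal_coord i2; have := horizontal_coord i2N.
rewrite opprK => -[w1 w2 w3].
have w3' : horizontal (- i) tX = 2 * constp i * zeta (- i).
  by rewrite w3 mpolyCN mulrN mulNr opprK.
apply: (mulfI (two_neq0 R)); rewrite (subLaplacianE _ i2).
exact: (@sum_of_squares_monomial _ (horizontal (- i)) (horizontal i)
  (constp i) (zeta i) (zeta (- i)) tX a b c
  (horizontal_derivation _) (horizontal_derivation _)
  (horizontalC _ _) (horizontalC _ _) (sqr_const i2) w1 w2 w3' z2 z1 z3).
Qed.

(** Triangularity in the degree in t: up to the factor 4(a+1)(b+1), the image
    of z^(a+1) zbar^(b+1) t^c is the target plus two monomials of lower degree
    in t, which are images by induction. *)
Lemma subLaplacian_onto_monomial (R : realType) (i : R[i]) a b c :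
  i ^+ 2 = -1 -> exists2 p : hpoly R, Phom (a + b + 2 * c + 2)%N%:Z p &
    subLaplacian p = zeta i ^+ a * zeta (- i) ^+ b * tX ^+ c.
Proof.
move=> i2; elim/ltn_ind: c a b => c IH a b.
pose d := (a + b + 2 * c + 2)%N%:Z.
have [p1 Hp1 E1] : exists2 p : hpoly R, Phom d p & subLaplacian p =
    c%:R * (zeta i ^+ a.+1 * zeta (- i) ^+ b.+1 * tX ^+ c.-1).
  case: c IH @d => [|c] IH d.
    by exists 0; [exact: Phom0 | rewrite mul0r subLaplacian0].
  have [p Hp Ep] := IH c (ltnSn c) a.+1 b.+1.
  exists (constp c.+1%:R * p); last by rewrite subLaplacianC Ep mpolyC_nat.
  by apply: PhomZ; move: Hp; congr (Phom _ _); rewrite /d; lia.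
have [p2 Hp2 E2] : exists2 p : hpoly R, Phom d p & subLaplacian p =
    c%:R * c.-1%:R * (zeta i ^+ a.+2 * zeta (- i) ^+ b.+2 * tX ^+ c.-2).
  case: c IH @d {Hp1 E1} => [|[|c]] IH d.
  - by exists 0; [exact: Phom0 | rewrite !mul0r subLaplacian0].
  - by exists 0; [exact: Phom0 | rewrite mulr0 mul0r subLaplacian0].
  have [p Hp Ep] := IH c (ltnW (ltnSn _)) a.+2 b.+2.
  exists (constp (c.+2%:R * c.+1%:R) * p).
    by apply: PhomZ; move: Hp; congr (Phom _ _); rewrite /d; lia.
  by rewrite subLaplacianC Ep mpolyCM !mpolyC_nat.
pose l : R[i] := (4 * a.+1%:R * b.+1%:R)^-1.
pose m := zeta i ^+ a.+1 * zeta (- i) ^+ b.+1 * tX ^+ c.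
exists (constp l *
  (m + constp (4 * i * (a%:R - b%:R)) * p1 + constp (- 4) * p2)).
  apply: PhomZ; apply: PhomD; [apply: PhomD|]; [|exact: PhomZ|exact: PhomZ].
  have -> : (a + b + 2 * c + 2)%N%:Z = 1 * a.+1%:Z + 1 * b.+1%:Z + 2 * c%:Z.
    by lia.
  by apply: PhomM; [apply: PhomM|]; apply: Phom_exp;
    [exact: Phom_zeta | exact: Phom_zeta | exact: Phom_tX].
rewrite subLaplacianC !subLaplacianD !subLaplacianC E1 E2.
rewrite subLaplacian_monomial //.
have El : constp l * (4 * a.+1%:R * b.+1%:R) = 1.
  have -> : 4 * a.+1%:R * b.+1%:R = constp (4 * a.+1%:R * b.+1%:R) :> hpoly R.
    by rewrite !mpolyCM !mpolyC_nat.
  by rewrite -mpolyCM mulVf ?mpolyC1 // !mulf_neq0 // pnatr_eq0.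
rewrite !mpolyCM mpolyCB mpolyCN !mpolyC_nat.
have key (L A X Y M e d4 : hpoly R) : L * A = 1 ->
  L * (A * M - 4 * e * d4 * X + 4 * Y + 4 * e * d4 * X + - 4 * Y) = M.
  by move=> LA; ring: LA.
exact: key.
Qed.

(** A surjective endomorphism of a finite-dimensional space is injective.  The
    space is a predicate P with coordinates c relative to a family e, which
    spares building a type for the polynomials of given weight. *)
Lemma surjective_injective (F : fieldType) (V : lmodType F) n
    (P : V -> Prop) (e : 'I_n -> V) (c : V -> 'rV[F]_n) (T : V -> V) :
  (forall a, {morph c : x y / a *: x + y}) ->
  (forall a, {morph T : x y / a *: x + y}) ->
  (forall i, c (e i) = delta_mx 0 i) ->
  (forall v, P v -> v = \sum_i c v 0 i *: e i) ->
  (forall i, exists2 q, P q & T q = e i) ->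
  forall v, P v -> T v = 0 -> v = 0.
Proof.
move=> cL TL ce Pe Te v Pv Tv.
have c0 : c 0 = 0 by have := cL (-1) 0 0; rewrite scaleN1r addNr scaleN1r addNr.
have T0 : T 0 = 0 by have := TL (-1) 0 0; rewrite scaleN1r addNr scaleN1r addNr.
have cT w : P w -> c (T w) = c w *m \matrix_i c (T (e i)).
  move=> Pw; rewrite {1}(Pe w Pw) mulmx_sum_row.
  elim/big_rec2: _ => [|i x y _ IH]; first by rewrite T0.
  by rewrite TL cL IH rowK.
have /choice[q Hq] : forall i, exists q, P q /\ T q = e i.
  by move=> i; have [q Pq Tq] := Te i; exists q.
have BA : (\matrix_i c (q i)) *m (\matrix_i c (T (e i))) = 1%:M.
  apply/row_matrixP => i; rewrite row_mul rowK -(cT _ (Hq i).1) (Hq i).2 ce.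
  by rewrite row1.
have AB := mulmx1C BA.
have cv : c v = 0.
  have := cT v Pv; rewrite Tv c0 => /(congr1 (mulmx^~ (\matrix_i c (q i)))).
  by rewrite mul0mx -mulmxA AB mulmx1.
by rewrite (Pe v Pv) big1 // => i _; rewrite cv mxE scale0r.
Qed.

Definition lap_mulw {R : realType} (q : hpoly R) := subLaplacian (wpoly * q).

Lemma lap_mulw_onto_monomial (R : realType) (i : R[i]) a b c : i ^+ 2 = -1 ->
  exists2 q : hpoly R, Phom (a + b + 2 * c)%N%:Z q &
    lap_mulw q = zeta i ^+ a * zeta (- i) ^+ b * tX ^+ c.
Proof.
move=> i2; have [p Hp <-] := subLaplacian_onto_monomial a b c i2.
have [h [q [_ Lh Hq ->]]] := Phom_decomposable Hp.
exists q; first by move: Hq; congr (Phom _ _); lia.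
by rewrite subLaplacianD Lh add0r.
Qed.

Lemma lap_mulwD (R : realType) : {morph @lap_mulw R : p q / p + q}.
Proof. by move=> p q; rewrite /lap_mulw mulrDr subLaplacianD. Qed.
Lemma lap_mulwC (R : realType) c (p : hpoly R) :
  lap_mulw (constp c * p) = constp c * lap_mulw p.
Proof. by rewrite /lap_mulw mulrCA subLaplacianC. Qed.
Lemma lap_mulw0 (R : realType) : @lap_mulw R 0 = 0.
Proof. by rewrite /lap_mulw mulr0 subLaplacian0. Qed.

Lemma lap_mulw_surjective (R : realType) (m : int) (p : hpoly R) :
  Phom m p -> exists2 q, Phom m q & lap_mulw q = p.
Proof.
case: m => m; last by move=> ->; exists 0; [exact: Phom0 | exact: lap_mulw0].
apply: (@Phom_span _ _ (fun p => exists2 q, Phom m%:Z q & lap_mulw q = p)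
  _ (sqr_i_eqN1 R)).
- by exists 0; [exact: Phom0 | exact: lap_mulw0].
- move=> p1 p2 [q1 H1 E1] [q2 H2 E2]; exists (q1 + q2); first exact: PhomD.
  by rewrite lap_mulwD E1 E2.
- move=> d p1 [q1 H1 E1]; exists (constp d * q1); first exact: PhomZ.
  by rewrite lap_mulwC E1.
- by move=> a b c <-; exact: lap_mulw_onto_monomial (sqr_i_eqN1 R).
Qed.

Lemma lap_mulw_injective (R : realType) (m : int) (p : hpoly R) :
  Phom m p -> lap_mulw p = 0 -> p = 0.
Proof.
case: m => m; last by [].
pose S := finset (fun k : bmultinom 3 m.+1 => weight k == m).
pose ev (i : 'I_#|S|) : multinom 3 := bmnm (enum_val i).
pose e (i : 'I_#|S|) : hpoly R := mpolyX R[i] (ev i).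
pose c (v : hpoly R) : 'rV[R[i]]_#|S| := \row_i mcoeff (ev i) v.
apply: (@surjective_injective _ _ _ (Phom m%:Z) e c).
- by move=> a u v; apply/rowP => i; rewrite !mxE mcoeffD mcoeffZ.
- by move=> a u v; rewrite -!mul_mpolyC lap_mulwD lap_mulwC.
- move=> i; apply/rowP => j; rewrite !mxE mcoeffX eqxx /= -bmeqP.
  by rewrite (inj_eq enum_val_inj) eq_sym.
- move=> v /PhomP Hv; rewrite {1}(@mpolywE _ _ m.+1 v).
    rewrite (bigID (mem S)) /= [X in _ + X]big1 ?addr0.
      by rewrite big_enum_val; apply: eq_bigr => i _; rewrite mxE.
    move=> k; rewrite inE => Hk; have [->|/Hv[E]] := eqVneq (mcoeff k v) 0.
      by rewrite scale0r.
    by rewrite E eqxx in Hk.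
  rewrite msizeE; apply/bigmax_leqP_seq => k; rewrite mcoeff_msupp => /Hv[<-] _.
  by rewrite ltnS mdegE big_ord3 /weight leq_add2l leq_pmull.
- move=> i; apply: lap_mulw_surjective; apply/PhomP => k; rewrite mcoeffX.
  have := enum_valP i; rewrite inE => /eqP Ei.
  by have [<- _|_] := eqVneq (ev i) k; rewrite ?eqxx // Ei.
Qed.

Lemma Phom_direct_sum (R : realType) (m : nat) :
  direct_sum (@Phom R m%:Z) (Hharm m%:Z) (wPhom (m%:Z - 2)) /\
     (forall p : hpoly R, Phom m%:Z p ->
        exists! hq : hpoly R * hpoly R,
          [/\ Hharm m%:Z hq.1, Phom (m%:Z - 2) hq.2 & p = hq.1 + wpoly * hq.2]).
Proof.
have Hw q : Phom (m%:Z - 2) q -> Phom m%:Z (wpoly * q : hpoly R).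
  move=> Hq; rewrite (_ : m%:Z = 2 + (m%:Z - 2)); last by lia.
  apply: PhomM => //; rewrite (wpolyE (sqr_i_eqN1 R)) -(mpolyC_nat 3 R[i] 4).
  apply: PhomD; last by apply: PhomZ; exact: Phom_tX.
  exact: (PhomM (Phom_zeta R _) (Phom_zeta R _)).
have dec (p : hpoly R) : Phom m%:Z p ->
    exists h q, [/\ Hharm m%:Z h, Phom (m%:Z - 2) q & p = h + wpoly * q].
  move=> Hp; have [q Hq Eq] := lap_mulw_surjective (Phom_subLaplacian Hp).
  exists (p - wpoly * q), q; split; [ | exact: Hq | by rewrite subrK].
  split; first by apply: PhomB; [exact: Hp | exact: Hw].
  rewrite -mulN1r -mpolyC1 -mpolyCN subLaplacianD subLaplacianC.
  rewrite -/(lap_mulw q) Eq.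
  by rewrite mpolyCN mpolyC1 mulN1r subrr.
have uniq (q : hpoly R) :
    Phom (m%:Z - 2) q -> subLaplacian (wpoly * q) = 0 -> q = 0.
  exact: lap_mulw_injective.
split; first split.
- apply/seteqP; split=> [p /dec[h [q [Hh Hq ->]]]|
                         p [h [Hh _]] [_ [q Hq <-] <-]].
    exists h; first exact: Hh.
    by exists (wpoly * q); [exists q; [exact: Hq |] |].
  by apply: PhomD; [exact: Hh | exact: Hw].
- apply/seteqP; split=> [p [[_ Lp] [q Hq Ep]]|p ->].
    by move: Lp; rewrite -Ep => /(uniq _ Hq) ->; rewrite mulr0.
  split; first by split; [exact: Phom0 | exact: subLaplacian0].
  by exists 0; [exact: Phom0 | rewrite mulr0].
- move=> p /dec[h [q [Hh Hq Ep]]]; exists (h, q); split.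
    by split; [exact: Hh | exact: Hq | exact: Ep].
  move=> [h' q'] /= [Hh' Hq' Ep'].
  have E : h + - 1 * h' = wpoly * (q' + - 1 * q).
    have E0 : h + wpoly * q = h' + wpoly * q' by rewrite -Ep.
    have key (x y z t w : hpoly R) : x + w * y = z + w * t ->
        x + -1 * z = w * (t + -1 * y).
      by move=> e; rewrite -[x](addrK (w * y)) e; ring.
    exact: key.
  have N1 : constp (-1) = -1 :> hpoly R by rewrite mpolyCN mpolyC1.
  have : q' + -1 * q = 0.
    apply: uniq.
      by rewrite -N1; apply: PhomD; [exact: Hq' | exact: PhomZ].
    rewrite -E -N1 subLaplacianD subLaplacianC.
    by rewrite (Hh.2) (Hh'.2) mulr0 addr0.
  rewrite mulN1r => /eqP; rewrite subr_eq0 => /eqP Eq.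
  by move: Ep; rewrite Ep' Eq => /addIr ->.
Qed.

(** * Failure of orthogonality *)

Definition sqnorm {R : realType} (a : heis R) : R := a.1.1 ^+ 2 + a.1.2 ^+ 2.
Definition wfun {R : realType} (a : heis R) : R := sqnorm a + 4 * a.2.

Lemma heval_zeta (R : realType) (c : R[i]) x y t :
  heval (zeta c) (x, y, t) = Complex x 0 + c * Complex y 0.
Proof. by rewrite hevalD hevalM hevalC heval_xX heval_yX. Qed.

Lemma heval_wpoly (R : realType) (a : heis R) :
  heval wpoly a = real_complex R (wfun a).
Proof.
case: a => [[x y] t]; rewrite /wpoly !expr2 -(mpolyC_nat 3 R[i] 4).
rewrite !(hevalD, hevalM) hevalC heval_xX heval_yX heval_tX /wfun /sqnorm /=.
by rewrite -(rmorph_nat (real_complex R) 4) -!rmorphM -!rmorphD !expr2.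
Qed.

Lemma heval_axial11 (R : realType) (x y t : R) :
  heval (axial ('i) 1 1) (x, y, t) =
  Complex x y * Complex t (2^-1 * (x ^+ 2 + y ^+ 2)).
Proof.
have m1 : moment R[i] 1 1 = Complex 2^-1 0.
  rewrite /moment /= mul1r -[RHS]/(real_complex R 2^-1) fmorphV.
  by rewrite rmorph_nat.
have -> : axial ('i) 1 1 = zeta ('i) * (tX * constp 1 +
    constp ('i) * (zeta ('i) * zeta (- 'i))
    * constp (moment R[i] 1 1)) :> hpoly R by rewrite /axial expr1.
rewrite m1 !(hevalM, hevalD) !hevalC heval_tX heval_xX heval_yX.
apply/eqP; rewrite eq_complex /=; apply/andP; split; apply/eqP; ring.
Qed.

Lemma re_im_product (R : realType) (a : heis R) :
  let g := heval (axial ('i) 1 1) a *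
           (conjc (heval (wpoly * zeta ('i)) a)) in
  complex.Re g = sqnorm a * wfun a * a.2 /\
  complex.Im g = 2^-1 * (sqnorm a ^+ 2 * wfun a).
Proof.
case: a => [[x y] t]; rewrite hevalM heval_wpoly heval_axial11 heval_zeta.
by move: (wfun _) => w; rewrite /sqnorm /=; split; ring.
Qed.

Lemma measurable_sqnorm (R : realType) : measurable_fun setT (@sqnorm R).
Proof.
by apply: measurable_funD; apply: measurable_funX;
  [apply: (measurableT_comp measurable_fst) |
   apply: (measurableT_comp measurable_snd)];
  exact: measurable_fst.
Qed.

Lemma measurable_wfun (R : realType) : measurable_fun setT (@wfun R).
Proof.
apply: measurable_funD; first exact: measurable_sqnorm.
by apply: measurable_funM; [exact: measurable_cst | exact: measurable_snd].
Qed.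

Lemma S_rhoE (R : realType) :
  @S_rho R = ((fun a => sqnorm a ^+ 2 + a.2 ^+ 2) @^-1` [set 1])%classic.
Proof. by apply/seteqP; split=> -[[x y] t]. Qed.

Lemma measurable_S_rho (R : realType) : measurable (@S_rho R).
Proof.
rewrite S_rhoE -[X in measurable X]setTI.
have mf : measurable_fun setT (fun a : heis R => sqnorm a ^+ 2 + a.2 ^+ 2).
  by apply: measurable_funD; apply: measurable_funX;
    [exact: measurable_sqnorm | exact: measurable_snd].
exact: mf.
Qed.

Lemma S_rho_bound (R : realType) (a : heis R) : S_rho a ->
  [/\ 0 <= sqnorm a <= 1, `|a.2| <= 1 & `|wfun a| <= 5].
Proof.
rewrite S_rhoE /= => H; have r0 : 0 <= sqnorm a by rewrite addr_ge0 ?sqr_ge0.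
have r1 : sqnorm a <= 1.
  by rewrite -(expr_le1 (n := 2)) // -H lerDl sqr_ge0.
have t1 : `|a.2| <= 1.
  rewrite -(expr_le1 (n := 2)) // -normrX ger0_norm ?sqr_ge0 //.
  by rewrite -H lerDr sqr_ge0.
split=> //; first by rewrite r0.
rewrite /wfun; move: t1; rewrite !ler_norml => /andP[? ?].
by apply/andP; split; lra.
Qed.

Lemma integrable_on_S_rho (R : realType)
    (sigma : {finite_measure set (heis R) -> \bar R}) (f : heis R -> R) M :
  measurable_fun setT f -> (forall a, S_rho a -> `|f a| <= M) ->
  sigma.-integrable S_rho (EFin \o f).
Proof.
move=> mf fM; apply: measurable_bounded_integrable.
- exact: measurable_S_rho.
- by rewrite ltey_eq fin_num_measure //; exact: measurable_S_rho.
- exact: measurable_funTS.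
- exists M; split; first exact: num_real.
  by move=> N MN a Sa; exact: le_trans (fM a Sa) (ltW MN).
Qed.

(** Orthogonality in degree 3 kills the integrals of r w t and r^2 w / 2, and
    r w^2 = 4 (r w t) + 2 (r^2 w / 2). *)
Lemma orthogonal_integral0 (R : realType)
    (sigma : {finite_measure set (heis R) -> \bar R}) :
  orthogonal_on_S sigma (Hharm 3%:Z) (wPhom (3%:Z - 2)) ->
  (\int[sigma]_(a in S_rho) (sqnorm a * wfun a ^+ 2)%:E = 0)%E.
Proof.
set p := axial ('i) 1 1 : hpoly R.
have Hp : Hharm 3%:Z p.
  split; last exact: axial_harmonic (sqr_i_eqN1 R).
  rewrite (_ : 3%:Z = 1 + 2); last by [].
  apply: PhomM; first by rewrite expr1; exact: Phom_zeta.
  apply: (@Phom_umbral _ _ _ _ 1); [|exact: Phom_tX|by move=> j; exact: PhomC].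
  by apply: PhomZ; exact: (PhomM (Phom_zeta R _) (Phom_zeta R _)).
have Hq : wPhom (3%:Z - 2) (wpoly * zeta ('i) : hpoly R).
  by exists (zeta ('i)) => //; exact: Phom_zeta.
move=> /(_ _ _ Hp Hq) [] J1 J2.
have I1 : (\int[sigma]_(a in S_rho) (sqnorm a * wfun a * a.2) = 0)%R.
  by rewrite -[RHS]J1; apply: eq_Rintegral => a _; rewrite (re_im_product a).1.
have I2 : (\int[sigma]_(a in S_rho) (2^-1 * (sqnorm a ^+ 2 * wfun a)) = 0)%R.
  by rewrite -[RHS]J2; apply: eq_Rintegral => a _; rewrite (re_im_product a).2.
have ms := @measurable_sqnorm R; have mw := @measurable_wfun R.
have i1 : sigma.-integrable S_rho (EFin \o (fun a => sqnorm a * wfun a * a.2)).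
  apply: (@integrable_on_S_rho _ _ _ 5).
    by apply: measurable_funM; [exact: measurable_funM | exact: measurable_snd].
  move=> a /S_rho_bound[/andP[r0 r1] t1 w5]; rewrite !normrM (ger0_norm r0).
  rewrite -[leRHS]mulr1 ler_pM // ?mulr_ge0 // -[leRHS]mul1r ler_pM //.
have i2 : sigma.-integrable S_rho
    (EFin \o (fun a => 2^-1 * (sqnorm a ^+ 2 * wfun a))).
  apply: (@integrable_on_S_rho _ _ _ 5).
    by apply: measurable_funM; [exact: measurable_cst |
      apply: measurable_funM; [exact: measurable_funX | ]].
  move=> a /S_rho_bound[/andP[r0 r1] t1 w5].
  rewrite (normrM 2^-1) (normrM (_ ^+ 2)) normrX (ger0_norm r0).
  rewrite -[leRHS]mul1r ler_pM ?mulr_ge0 ?exprn_ge0 //.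
    by rewrite ger0_norm ?invr_ge0 // invf_le1 ?ler1n.
  by rewrite -[leRHS]mul1r ler_pM ?exprn_ge0 // exprn_ile1.
pose f (a : heis R) := sqnorm a * wfun a ^+ 2.
have fE a : f a = 4 * (sqnorm a * wfun a * a.2) +
                  2 * (2^-1 * (sqnorm a ^+ 2 * wfun a)).
  by rewrite /f /wfun; field.
have mS := @measurable_S_rho R.
have j1 : sigma.-integrable S_rho
    (EFin \o (fun a => 4 * (sqnorm a * wfun a * a.2))).
  exact: (integrableZl mS 4 i1).
have j2 : sigma.-integrable S_rho
    (EFin \o (fun a => 2 * (2^-1 * (sqnorm a ^+ 2 * wfun a)))).
  exact: (integrableZl mS 2 i2).
have If : (\int[sigma]_(a in S_rho) f a = 0)%R.
  rewrite (eq_Rintegral sigma (fun a _ => fE a)) RintegralD //.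
  by rewrite (RintegralZl 4 mS i1) (RintegralZl 2 mS i2) I1 I2 !mulr0 addr0.
have jf : sigma.-integrable S_rho (EFin \o f).
  have := integrableD mS j1 j2; congr (sigma.-integrable _ _).
  by apply/funext => a; rewrite /= fE EFinD.
have := integrable_fin_num mS jf.
by move=> /fineK <-; congr EFin.
Qed.

Lemma sqnorm_wfun_dil (R : realType) (s : R) a :
  sqnorm (dil s a) * wfun (dil s a) ^+ 2 = s ^+ 6 * (sqnorm a * wfun a ^+ 2).
Proof. by case: a => [[x y] t]; rewrite /wfun /sqnorm /=; ring. Qed.

(** On the box [1,2] x [0,1] x [0,1], of volume 1, both r and w are at least
    1. *)
Lemma lebesgue_integral_sqnorm_wfun (R : realType) :
  (1 <= \int[(@lebesgue_measure R \x @lebesgue_measure R)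
           \x @lebesgue_measure R]_a (sqnorm a * wfun a ^+ 2)%:E)%E.
Proof.
pose B : set (heis R) := (`[1, 2] `*` `[0, 1] `*` `[0, 1])%classic.
have mB : measurable B by do 2!apply: measurableX => //; exact: measurable_itv.
have -> : (1 = ((@lebesgue_measure R \x @lebesgue_measure R)
           \x @lebesgue_measure R) B)%E.
  rewrite /B product_measure1E ?measurable_itv //; last exact: measurableX.
  rewrite [X in (X * _)%E]product_measure1E ?measurable_itv //.
  have L (u v : R) : u < v -> @lebesgue_measure R `[u, v]%classic = (v - u)%:E.
    by move=> uv; rewrite lebesgue_measure_itv /= lte_fin uv.
  rewrite [X in (X * _ * _)%E](L 1 2) ?ltr1n // [X in (_ * X)%E](L 0 1) //.
  rewrite [X in (_ * X * _)%E](L 0 1) // -!EFinM.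
  by rewrite subr0 !mulr1 (_ : 2 - 1 = 1 :> R) //; ring.
rewrite -[X in (_ X <= _)%E]setIT -integral_indic //.
apply: ge0_le_integral => //.
- exact/measurable_EFinP/measurable_indic.
- apply/measurable_EFinP/measurable_funM; first exact: measurable_sqnorm.
  by apply: measurable_funX; exact: measurable_wfun.
move=> [[x y] t] _; rewrite lee_fin indicE.
have [|_] := boolP (_ \in B); last first.
  by rewrite mulr_ge0 ?sqr_ge0 // addr_ge0 ?sqr_ge0.
rewrite inE => -[[/=]]; rewrite !in_itv /=.
move=> /andP[x1 _] /andP[y0 _] /andP[t0 _].
have r1 : 1 <= sqnorm (x, y, t) by rewrite /sqnorm /=; nra.
have w1 : 1 <= wfun (x, y, t) by rewrite /wfun /=; lra.
nra.
Qed.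

(** The function r w^2 is homogeneous of degree 6, so in polar coordinates
    each inner integral is s^9 times an integral that vanishes. *)
Lemma not_orthogonal (R : realType)
    (sigma : {finite_measure set (heis R) -> \bar R}) :
  is_surface_measure sigma ->
  ~ orthogonal_on_S sigma (Hharm 3%:Z) (wPhom (3%:Z - 2)).
Proof.
move=> [_ polar] /orthogonal_integral0 I0.
have mf : measurable_fun setT (fun a : heis R => (sqnorm a * wfun a ^+ 2)%:E).
  apply/measurable_EFinP/measurable_funM; first exact: measurable_sqnorm.
  by apply: measurable_funX; exact: measurable_wfun.
have f0 (a : heis R) : (0 <= (sqnorm a * wfun a ^+ 2)%:E)%E.
  by rewrite lee_fin mulr_ge0 ?sqr_ge0 // addr_ge0 ?sqr_ge0.
have := lebesgue_integral_sqnorm_wfun R; rewrite polar //.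
rewrite (@eq_integral _ _ _ _ _ (fun=> 0%E)).
  by rewrite integral0 lee_fin ler10.
move=> s; rewrite inE /= in_itv /= andbT => s0.
rewrite (@eq_integral _ _ _ _ _
  (fun a => (s ^+ 9)%:E * (sqnorm a * wfun a ^+ 2)%:E)%E).
  rewrite ge0_integralZl_EFin ?I0 ?mule0 //.
  - exact: measurable_S_rho.
  - exact: measurable_funTS.
  - by rewrite exprn_ge0 // ltW.
by move=> a _; rewrite sqnorm_wfun_dil -!EFinM; congr EFin; ring.
Qed.

Local Close Scope complex_scope.

Theorem theorem1p3 (R : realType) :
  (forall m : nat,
     direct_sum (@Phom R m%:Z) (Hharm m%:Z) (wPhom (m%:Z - 2)) /\
     (forall p : hpoly R, Phom m%:Z p ->
        exists! hq : hpoly R * hpoly R,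
          [/\ Hharm m%:Z hq.1, Phom (m%:Z - 2) hq.2 & p = hq.1 + wpoly * hq.2])) /\
  (forall sigma : {finite_measure set (heis R) -> \bar R},
     is_surface_measure sigma ->
     ~ (forall m : nat,
          orthogonal_on_S sigma (Hharm m%:Z) (wPhom (m%:Z - 2)))).
Proof.
split; first exact: Phom_direct_sum.
by move=> sigma Hsigma H; exact: not_orthogonal Hsigma (H 3).
Qed.
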